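(* Let $\Gamma$ be a compact open subset of $\mathrm{GL}_n(\mathcal O_{E,v})$, and let $$F:\mathrm{Hom}_{K_v}(V_v,V_{d,v})\oplus\mathrm{Hom}_{K_v}(V_v,V^d_v)\to\bar{\mathbb Q},\qquad (X_1,X_2)\mapsto F(X_1,X_2),$$ be a locally constant Schwartz function whose support in the first variable is $\Gamma$ and such that $$F(X,{}^tX^{-1}Y)=\chi_1\chi_2^{-1}(\det X)\,F(1,Y)$$ for all $X\in\Gamma$ and $Y\in M_n(E_v)$. Then for every $\beta\in M_n(E_v)$ the Fourier coefficient at $\beta$ of the section $f^{PF(-X,Y)}$ (the section $f^{\Phi}$ attached to $\Phi(X,Y)=PF(-X,Y)$) is $$c(\beta,1;f^{PF(-X,Y)})=f^{PF(-X,Y)}_\beta(1)=\mathrm{volume}(\Gamma)\cdot F(1,{}^t\beta).$$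
   Context: $K$ is a CM field with maximal totally real subfield $E$, $p$ is a rational prime unramified in $K$ all of whose prime divisors in $E$ split in $K$, and $v$ is one of the chosen primes of $K$ above $p$ (one over each prime of $E$ above $p$), so $K_v=E_v$, with ring of integers $\mathcal O_{E,v}$. $V$ is an $n$-dimensional $K$-vector space, $V_v=V\otimes_KK_v$, and $W_v=V_{d,v}\oplus V^d_v$ where $V_d=\{(x,-x)\}$, $V^d=\{(x,x)\}\subset V\oplus V$, both identified with $V$; using a basis of $V$, the two Hom spaces are identified with $M_n(E_v)$, so $(X_1,X_2)$ is an $n\times2n$ matrix on which $\mathrm{GL}_{2n}(E_v)$ acts by right multiplication. $\chi_1=\chi_{1,v},\chi_2=\chi_{2,v}$ are the characters of $E_v^\times$ obtained from a unitary Hecke character $\chi$ of $K$ by $\chi_p=(\chi_1,\chi_2^{-1})$, i.e. $\chi_1=\chi|_{K_v^\times}$ and $\chi_2=(\chi|_{K_{\bar v}^\times})^{-1}$ with $K_v=K_{\bar v}=E_v$. The unitary group $G=U(n,n)$ satisfies $G(E_v)\cong\mathrm{GL}_{2n}(E_v)$, and $P$ is the subgroup of block upper triangular matrices. $s\in\mathbb C$ is a fixed parameter. To a Schwartz function $\Phi$ on $M_n(E_v)\oplus M_n(E_v)$ one attaches the Siegel section $$f^\Phi(g)=\chi_2(\det g)|\det g|_v^{2s}\int_{\mathrm{GL}_n(E_v)}\Phi\big((0,X)g\big)\,\chi_1^{-1}\chi_2(\det X)\,|\det X|_v^{4s}\,d^\times X .$$ Its local Fourier coefficient at $\beta\in M_n(E_v)$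 is $$c(\beta,1;f^\Phi)=f^\Phi_\beta(1)=\int_{M_n(E_v)}f^\Phi\left(\begin{pmatrix}0&1_n\\-1_n&0\end{pmatrix}\begin{pmatrix}1_n&N\\0&1_n\end{pmatrix}\right)\mathbf e_v(-\mathrm{tr}(\beta N))\,dN .$$ The partial Fourier transform in the second variable is $$PF(X_1,X_2)=\int_{M_n(E_v)}F(X_1,Y)\,\mathbf e_v\big(-\mathrm{tr}(Y\cdot{}^tX_2)\big)\,dY .$$ Here $\mathbf e_v(x)=e^{-2\pi iy}$ with $y\in\mathbb Z[1/p]$, $\mathrm{tr}_{E_v/\mathbb Q_p}(x)-y\in\mathbb Z_p$; the measure on $M_n(E_v)$ gives $M_n(\mathcal O_{E,v})$ volume $1$ (self-dual, so $PPF(X_1,X_2)=F(X_1,-X_2)$); $\mathrm{volume}(\Gamma)$ is taken with respect to the Haar measure $d^\times X$ on $\mathrm{GL}_n(E_v)$. Elements of $\bar{\mathbb Q}$ are regarded as complex numbers via a fixed embedding. *)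

(* Defs.v *)
From HB Require Import structures.
From mathcomp Require Import all_boot all_order all_algebra all_field.
From mathcomp Require Import all_classical all_reals all_analysis.
From mathcomp Require Import complex.

Set Implicit Arguments.
Unset Strict Implicit.
Unset Printing Implicit Defensive.

Import Order.TTheory GRing.Theory Num.Theory.
Import numFieldNormedType.Exports.

Local Open Scope classical_set_scope.
Local Open Scope complex_scope.
Local Open Scope ring_scope.

Definition absolute_value (R : realType) (F : fieldType) (a : F -> R) : Prop :=
  [/\ forall x, 0 <= a x,
      forall x, a x = 0 <-> x = 0,
      forall x y, a (x * y) = a x * a y &
      forall x y, a (x + y) <= a x + a y].

(* The absolute value of rat with value 1/p at p. *)
Definition padic_abs (R : realType) (p : nat) (q : rat) : R :=
  if q == 0 then 0
  else p%:R ^+ logn p `|denq q|%N / p%:R ^+ logn p `|numq q|%N.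

(* The place a lies above the rational prime p.  In particular a p = 1/p, so
   this is not the normalization of a by the size of the residue field. *)
Definition above (R : realType) (F : fieldType) (p : nat) (a : F -> R) : Prop :=
  forall q : rat, a (ratr q) = padic_abs R p q.

(* Every equivalence class of nontrivial absolute values of a number field has
   exactly one member that extends a standard (l-adic or usual) absolute value
   of rat; a place is that member.  The places above a prime number p are the
   prime ideals above p. *)
Record place (R : realType) (F : fieldType) := Place {
  place_abs :> F -> R ;
  place_absolute_value : absolute_value place_abs ;
  place_standard :
    (exists2 l, prime l & above l place_abs) \/
    (forall q : rat, place_abs (ratr q) = `|ratr q|) }.

Definition finite_place (R : realType) (F : fieldType) (w : place R F) : Prop :=
  exists2 l, prime l & above l w.

Definition lies_over (R : realType) (K : fieldExtType rat) (E : {subfield K})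
    (w : place R K) (u : place R (subvs_of E)) : Prop :=
  forall x : subvs_of E, w (vsval x) = u x.

(* The uniform structure is the one of the metric vabs (x - y). *)
HB.mixin Record Uniform_isValuedField (R : realType) L
    of GRing.Field L & Uniform L := {
  vabs : L -> R ;
  vabs_absolute_value : absolute_value vabs ;
  vabs_entourage :
    entourage = entourage_ (fun (x : L) (e : R) (y : L) => vabs (x - y) < e) }.

#[short(type="valuedFieldType")]
HB.structure Definition ValuedField (R : realType) :=
  {L of GRing.Field L & Uniform L & Uniform_isValuedField R L}.

(* The library's completeType is pointed, and the library has no join of
   pointed types and rings below its normed structures. *)
HB.mixin Record ValuedField_isComplete (R : realType) L of ValuedField R L := {
  vabs_complete :
    forall G : set_system L, ProperFilter G -> cauchy G -> exists x : L, G --> x }.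

#[short(type="completeValuedFieldType")]
HB.structure Definition CompleteValuedField (R : realType) :=
  {L of ValuedField R L & ValuedField_isComplete R L}.

Definition is_completion (R : realType) (F : fieldType) (a : F -> R)
    (L : completeValuedFieldType R) (i : F -> L) : Prop :=
  (forall x, vabs (i x) = a x) /\ dense (range i).

Definition is_CM (K : fieldExtType rat) (E : {subfield K}) : Prop :=
  [/\ \dim_E {:K} = 2%N,
      forall (sigma : {rmorphism subvs_of E -> algC}) x, sigma x \is Num.real &
      forall sigma : {rmorphism K -> algC}, exists x, sigma x \isn't Num.real].

Definition complex_conjugation (K : fieldExtType rat) (E : {subfield K})
    (c : {rmorphism K -> K}) : Prop :=
  (forall x, x \in E -> c x = x) /\ (exists x, c x <> x).

(* Ramification index one at every place above p: the value group is generated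
   by the value 1/p of p. *)
Definition unramified_in (R : realType) (K : fieldExtType rat) (p : nat) : Prop :=
  forall w : place R K, above p w ->
    forall x, x != 0 -> exists k : int, w x = p%:R ^ k.

Definition splits_in (R : realType) (K : fieldExtType rat) (E : {subfield K})
    (p : nat) : Prop :=
  forall u : place R (subvs_of E), above p u ->
    exists w1 w2 : place R K, [/\ lies_over w1 u, lies_over w2 u & w1 <> w2].

Definition one_over_each (R : realType) (K : fieldExtType rat)
    (E : {subfield K}) (p : nat) (S : set (place R K)) : Prop :=
  (forall w, S w -> above p w) /\
  (forall u : place R (subvs_of E), above p u ->
     exists! w, S w /\ lies_over w u).

Record completions (R : realType) (K : fieldType) := Completions {
  cpl : place R K -> completeValuedFieldType R ;
  cpl_emb : forall w, {rmorphism K -> cpl w} ;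
  cplP : forall w : place R K, is_completion w (cpl_emb w) }.

(* A number field has finitely many infinite places, so it is harmless that
   they are included in the set of idele_fin. *)
Record idele (R : realType) (K : fieldType) (C : completions R K) := Idele {
  idele_val :> forall w, cpl C w ;
  idele_neq0 : forall w, idele_val w != 0 ;
  idele_fin : finite_set [set w | vabs (idele_val w) != 1] }.

(* Products of ideles and principal ideles are described by their components.
   Continuity is continuity at 1 for the restricted product topology. *)
Record unitary_hecke (R : realType) (K : fieldType) (C : completions R K) :=
  UnitaryHecke {
  hecke :> idele C -> R[i] ;
  hecke_mul : forall x y z : idele C,
    (forall w, z w = x w * y w) -> hecke z = hecke x * hecke y ;
  hecke_unitary : forall x, `|hecke x| = 1 ;
  hecke_principal : forall (a : K) (x : idele C),
    (forall w, x w = cpl_emb C w a) -> hecke x = 1 ;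
  hecke_continuous : forall e : R, 0 < e ->
    exists (S : set (place R K)) (d : R),
      [/\ finite_set S, 0 < d &
        forall x : idele C,
          (forall w, S w -> vabs (x w - 1) < d) ->
          (forall w, ~ S w -> finite_place w -> vabs (x w) = 1) ->
          `|hecke x - 1| < e%:C] }.

(* phi is an isomorphism of valued fields from the completion at w to L that
   extends j : K -> L. *)
Definition identification (R : realType) (K : fieldType) (C : completions R K)
    (w : place R K) (L : completeValuedFieldType R) (j : K -> L)
    (phi : {rmorphism cpl C w -> L}) : Prop :=
  [/\ bijective phi, forall y, vabs (phi y) = vabs y &
      forall x, phi (cpl_emb C w x) = j x].

(* psi, transported by phi, is the component at w of chi; the value of psi at
   0 is irrelevant. *)
Definition local_component (R : realType) (K : fieldType) (C : completions R K)
    (chi : unitary_hecke C) (w : place R K) (L : completeValuedFieldType R)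
    (phi : {rmorphism cpl C w -> L}) (psi : L -> R[i]) : Prop :=
  forall x : idele C, (forall w', w' <> w -> x w' = 1) ->
    psi (phi (x w)) = chi x.

Definition cexp (R : realType) (z : R[i]) : R[i] :=
  (expR (complex.Re z))%:C * (cos (complex.Im z) +i* sin (complex.Im z)).

(* a ^ z, for a > 0. *)
Definition cpow (R : realType) (a : R) (z : R[i]) : R[i] :=
  cexp (z * (ln a)%:C).

Definition cintegral d (T : measurableType d) (R : realType)
    (mu : {measure set T -> \bar R}) (D : set T) (f : T -> R[i]) : R[i] :=
  (\int[mu]_(x in D) complex.Re (f x)) +i* (\int[mu]_(x in D) complex.Im (f x)).

(* A copy M of L, through the isomorphism g, as a finite extension of Qp. *)
Definition finite_extension (R : realType) (Qp L : completeValuedFieldType R)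
    (M : fieldExtType Qp) (g : {rmorphism L -> M}) : Prop :=
  bijective g /\ (forall (x : L) (a : Qp), g x = a%:A -> vabs x = vabs a).

Section Local.
Variables (R : realType) (Qp L : completeValuedFieldType R).
Variables (M : fieldExtType Qp) (g : {rmorphism L -> M}).

(* The absolute value of L normalized by the size of its residue field, when
   vabs extends the standard absolute value of Qp. *)
Definition norm_abs (x : L) : R := vabs x ^+ \dim {:M}.

Definition trace_Qp (x : L) : Qp :=
  \tr (passmx.mxof (vbasis {:M}) (vbasis {:M}) (amulr (g x))).

(* exp (- 2 pi i y) for any y in Z[1/p] such that trace x - y is in Z_p. *)
Definition e_char (p : nat) (x : L) : R[i] :=
  let y : rat := xget 0 [set y : rat |
    (exists k : nat, p%:R ^+ k * y \is a Num.int) /\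
    vabs (trace_Qp x - ratr y) <= 1] in
  cexp (0 +i* (- (2 * pi * ratr y))).

Variable n : nat.

(* Measurable types are pointed, and L is not. *)
Definition pointedM : Type := 'M[L]_n.
HB.instance Definition _ := Choice.on pointedM.
HB.instance Definition _ := isPointed.Build pointedM (0 : 'M[L]_n).

Definition borelM := g_sigma_algebraType (@open 'M[L]_n : set (set pointedM)).

Definition integral_mx : set 'M[L]_n := [set X | forall i j, vabs (X i j) <= 1].

Definition GL : set 'M[L]_n := [set X | X \in unitmx].

Definition GL_int : set 'M[L]_n :=
  [set X | integral_mx X /\ vabs (\det X) = 1].

Definition additive_haar (mu : {measure set borelM -> \bar R}) : Prop :=
  (forall (X : 'M[L]_n) (A : set borelM), measurable A ->
     mu [set X + Y | Y in (A : set 'M[L]_n)] = mu A) /\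
  mu integral_mx = 1%E.

(* A Haar measure of the open subset GL of 'M[L]_n, whose Borel sets are the
   Borel sets of 'M[L]_n contained in GL; the values of nu on other sets are
   never used. *)
Definition GL_haar (nu : {measure set borelM -> \bar R}) : Prop :=
  [/\ forall (g : 'M[L]_n) (A : set borelM), GL g -> measurable A ->
        A `<=` GL -> nu [set g *m Y | Y in (A : set 'M[L]_n)] = nu A,
      forall A : set 'M[L]_n, compact A -> A `<=` GL -> (nu A < +oo)%E &
      nu GL <> 0%E].

Definition partial_fourier (p : nat) (mu : {measure set borelM -> \bar R})
    (F : 'M[L]_n * 'M[L]_n -> R[i]) (X : 'M[L]_n * 'M[L]_n) : R[i] :=
  cintegral mu setT
    (fun Y : 'M[L]_n => F (X.1, Y) * e_char p (- \tr (Y *m X.2^T))).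

Definition siegel_section (chi1 chi2 : L -> R[i]) (s : R[i])
    (nu : {measure set borelM -> \bar R})
    (Phi : 'M[L]_n * 'M[L]_n -> R[i]) (g : 'M[L]_(n + n)) : R[i] :=
  chi2 (\det g) * cpow (norm_abs (\det g)) (2 * s) *
  cintegral nu GL (fun X : 'M[L]_n =>
    let Z : 'M[L]_(n, n + n) := row_mx 0 X *m g in
    Phi (lsubmx Z, rsubmx Z) * ((chi1 (\det X))^-1 * chi2 (\det X)) *
    cpow (norm_abs (\det X)) (4 * s)).

(* The Fourier coefficient at beta, evaluated at the identity. *)
Definition fourier_coeff (p : nat) (mu : {measure set borelM -> \bar R})
    (beta : 'M[L]_n) (f : 'M[L]_(n + n) -> R[i]) : R[i] :=
  cintegral mu setT (fun N : 'M[L]_n =>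
    f (block_mx 0 1%:M (- 1%:M) 0 *m block_mx 1%:M N 0 1%:M) *
    e_char p (- \tr (beta *m N))).

Definition schwartz (F : 'M[L]_n * 'M[L]_n -> algC) : Prop :=
  (forall x, \forall y \near x, F y = F x) /\
  (exists2 A : set ('M[L]_n * 'M[L]_n), compact A &
     forall x, ~ A x -> F x = 0).

End Local.

(* Main.v *)
Require Import Defs.
From HB Require Import structures.
From mathcomp Require Import all_boot all_order all_algebra all_field.
From mathcomp Require Import all_classical all_reals all_analysis.
From mathcomp Require Import complex.
From mathcomp Require Import measurable_realfun ring lra.

Set Implicit Arguments.
Unset Strict Implicit.
Unset Printing Implicit Defensive.

Import Order.TTheory GRing.Theory Num.Theory.
Import numFieldNormedType.Exports.

Local Open Scope classical_set_scope.
Local Open Scope complex_scope.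
Local Open Scope ring_scope.

(** Why the theorem holds.  At the product of the Weyl element and the unipotent
    matrix of N, the integrand of the section involves the function Phi at
    (- X, - X N), that is, the partial transform of F at (X, - X N).  It vanishes
    unless X lies in Gamma.  For X in Gamma, equivariance and the substitution of
    X^T Y for Y, which preserves the measure because X is in GL_n of the ring of
    integers O, turn it into chi1 chi2^-1 (det X) times the Fourier transform of
    h = F (1, -) at N (partial_fourier_Gamma).  The factor cancels the characters
    in the section and det X has absolute value one, so that the section is the
    volume of Gamma times the transform of h (siegel_section_big_cell).  Its
    Fourier coefficient is then given by Fourier inversion for h at the transpose
    of beta (fourier_inversion).

    The functions integrated over M_n are locally constant with compact support.
    By compactness each of them is supported in a box, the set of matrices with
    entries of absolute value at most p ^ m, and is invariant under the box of
    radius p ^- m (step_of_locally_constant).  Integrals are therefore finite sums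
    over representatives of the quotient (cintegral_stepE), linear substitutions
    by integral invertible matrices permute these cosets, and inversion is
    orthogonality of the characters of a finite group.  The constant in it is one
    because the box of radius one has volume one (vol_card) and because the
    additive character is trivial on O and on no larger fractional ideal.

    The last fact is where p being unramified enters (e_char_unramified).  The
    values of E_v are the powers of p, so E_v has an orthonormal basis over Q_p
    (orthonormal_basis): coordinates of integers are integers, the residues of
    the coordinates enumerate those of O, and traces of integers are integral.
    That some integer has trace a unit (unit_trace) is proved by averaging a
    coordinate functional over the units of the residue field, which gives, modulo
    p, a multiplication whose trace can be computed. *)

(** * Absolute values *)

Section AbsoluteValue.
Variables (R : realType) (F : fieldType) (a : F -> R).
Hypothesis ha : absolute_value a.

Lemma abs_ge0 x : 0 <= a x. Proof. by case: ha. Qed.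

Lemma absM x y : a (x * y) = a x * a y. Proof. by case: ha. Qed.

Lemma abs_eq0 x : (a x == 0) = (x == 0).
Proof. by case: ha => _ h _ _; apply/eqP/eqP => /h. Qed.

Lemma abs0 : a 0 = 0. Proof. by apply/eqP; rewrite abs_eq0. Qed.

Lemma abs_gt0 x : (0 < a x) = (x != 0).
Proof. by rewrite lt_neqAle abs_ge0 andbT eq_sym abs_eq0. Qed.

Lemma abs1 : a 1 = 1.
Proof.
have n0 : a 1 != 0 by rewrite abs_eq0 oner_eq0.
by apply: (mulfI n0); rewrite -absM !mulr1.
Qed.

Lemma absX x k : a (x ^+ k) = a x ^+ k.
Proof. by elim: k => [|k IH]; rewrite ?expr0 ?abs1 // !exprS absM IH. Qed.

Lemma absN x : a (- x) = a x.
Proof.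
apply/eqP; rewrite -(eqrXn2 (n := 2)) ?abs_ge0 //.
by rewrite -!absX sqrrN.
Qed.

Lemma absB x y : a (x - y) = a (y - x).
Proof. by rewrite -absN opprB. Qed.

Lemma absV x : a x^-1 = (a x)^-1.
Proof.
have [->|x0] := eqVneq x 0; first by rewrite invr0 abs0 invr0.
apply: (mulfI (x := a x)); first by rewrite abs_eq0.
by rewrite -absM !mulfV ?abs1 ?abs_eq0.
Qed.

End AbsoluteValue.

Lemma le1_of_expr_le (R : realType) (t : R) :
  (forall k, t ^+ k <= k.+1%:R) -> t <= 1.
Proof.
move=> h; rewrite leNgt; apply/negP => t1.
pose e := t - 1; have e0 : 0 < e by rewrite subr_gt0.
have bern k : 1 + k%:R * e <= t ^+ k.
  elim: k => [|k IH]; first by rewrite mul0r addr0 expr0.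
  rewrite exprS -natr1; apply: (@le_trans _ _ (t * (1 + k%:R * e))).
    have -> : t = 1 + e by rewrite /e addrC subrK.
    rewrite mulrDl mul1r mulrDl mul1r -addrA lerD2l lerD2l.
    by rewrite mulrDr mulr1 lerDl mulr_ge0 ?mulr_ge0 // ltW.
  by rewrite ler_pM2l // (lt_trans ltr01).
(* squaring Bernoulli's bound makes it quadratic in k *)
have quad k : k%:R * e ^+ 2 <= 2.
  have [->|k0] := posnP k; first by rewrite mul0r.
  have := h (k * 2)%N; rewrite exprM => h2.
  have ke0 : 0 <= k%:R * e by rewrite mulr_ge0 // ltW.
  have := le_trans (lerXn2r 2 _ _ (bern k)) h2.
  rewrite !nnegrE addr_ge0 // exprn_ge0 ?(ltW (lt_trans ltr01 t1)) // => /(_ isT isT).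
  rewrite -natr1 natrM => h3.
  have {}h3 : (k%:R * e) ^+ 2 <= k%:R * 2 by nra.
  have k0' : 0 < k%:R :> R by rewrite ltr0n.
  by move: h3; rewrite exprMn expr2 -mulrA ler_pM2l.
pose k := Num.bound (2 / e ^+ 2).
have := archi_boundP (divr_ge0 (ler0n R 2) (exprn_ge0 2 (ltW e0))).
rewrite ltr_pdivrMr ?exprn_gt0 // -/k => h4.
by have := le_lt_trans (quad k) h4; rewrite ltxx.
Qed.

Definition ultrametric (R : realType) (F : fieldType) (a : F -> R) : Prop :=
  forall x y, a (x + y) <= Num.max (a x) (a y).

(** Expand (x + y) ^ k: at most k + 1 terms, all bounded by the k-th power of
    the maximum, and the factor k + 1 disappears under k-th roots. *)
Lemma ultrametric_of_nat (R : realType) (F : fieldType) (a : F -> R) :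
  absolute_value a -> (forall k : nat, a k%:R <= 1) -> ultrametric a.
Proof.
move=> ha hn x y; set m := Num.max _ _.
have a0 := abs_ge0 ha.
have mx : a x <= m by rewrite le_max lexx.
have my : a y <= m by rewrite le_max lexx orbT.
have m0 : 0 <= m := le_trans (a0 x) mx.
have bnd k : a (x + y) ^+ k <= k.+1%:R * m ^+ k.
  rewrite -(absX ha) exprDn.
  have sum_le (f : 'I_k.+1 -> F) : a (\sum_i f i) <= \sum_i a (f i).
    elim/big_ind2: _ => [|r u s w hu hw|//]; first by rewrite (abs0 ha).
    by case: ha => _ _ _ /(_ u w) h; exact: le_trans h (lerD hu hw).
  apply: (le_trans (sum_le _)); rewrite mulr_natl -[X in _ *+ X]card_ord -sumr_const.
  apply: ler_sum => i _; rewrite -mulr_natl !(absM ha) !(absX ha).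
  have ik : (i <= k)%N by rewrite -ltnS.
  rewrite -[leRHS]mul1r ler_pM // ?mulr_ge0 ?exprn_ge0 //.
  rewrite -[in leRHS](subnK ik) exprD ler_pM ?exprn_ge0 //.
    by rewrite lerXn2r ?nnegrE.
  by rewrite lerXn2r ?nnegrE.
have [mp|] := ltrP 0 m; last first.
  move=> m0'; have m_eq0 : m = 0 by apply/eqP; rewrite eq_le m0' m0.
  have zero z : a z <= m -> z = 0.
    by move=> hz; apply/eqP; rewrite -(abs_eq0 ha) eq_le a0 -m_eq0 hz.
  by rewrite (zero _ mx) (zero _ my) addr0 (abs0 ha).
rewrite -(ler_pM2r (x := m^-1)) ?invr_gt0 // mulfV ?gt_eqF //.
apply: le1_of_expr_le => k.
rewrite exprMn exprVn ler_pdivrMr ?exprn_gt0 //.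
Qed.

Section Ultrametric.
Variables (R : realType) (F : fieldType) (a : F -> R).
Hypotheses (ha : absolute_value a) (hu : ultrametric a).

Lemma abs_leD x y r : a x <= r -> a y <= r -> a (x + y) <= r.
Proof. by move=> hx hy; apply: le_trans (hu x y) _; rewrite ge_max hx. Qed.

Lemma abs_leB x y r : a x <= r -> a y <= r -> a (x - y) <= r.
Proof. by move=> hx hy; apply: abs_leD; rewrite ?(absN ha). Qed.

Lemma abs_le_trans x y z r : a (x - y) <= r -> a (y - z) <= r -> a (x - z) <= r.
Proof. by move=> h1 h2; rewrite -(subrK y x) -addrA abs_leD. Qed.

Lemma abs_le_sum (I : Type) (s : seq I) (P : pred I) (f : I -> F) r :
  0 <= r -> (forall i, P i -> a (f i) <= r) -> a (\sum_(i <- s | P i) f i) <= r.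
Proof.
move=> r0 h; apply: (big_ind (fun x => a x <= r)) => [||//].
  by rewrite (abs0 ha).
by move=> x y; exact: abs_leD.
Qed.

Lemma abs_lt_sum (I : Type) (s : seq I) (P : pred I) (f : I -> F) r :
  0 < r -> (forall i, P i -> a (f i) < r) -> a (\sum_(i <- s | P i) f i) < r.
Proof.
move=> r0 h; apply: (big_ind (fun x => a x < r)) => [|x y hx hy|//].
  by rewrite (abs0 ha).
by apply: le_lt_trans (hu x y) _; rewrite gt_max hx.
Qed.

Lemma abs_eqD x y : a x < a y -> a (x + y) = a y.
Proof.
move=> xy; apply/eqP; rewrite eq_le abs_leD ?(ltW xy) //=.
have := hu (x + y) (- x); rewrite addrAC subrr add0r (absN ha).
by rewrite le_max => /orP[//|]; rewrite leNgt xy.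
Qed.

Lemma abs_eq_of_close x y : a (x - y) < a y -> a x = a y.
Proof. by move=> h; rewrite -[in LHS](subrK y x) abs_eqD. Qed.

End Ultrametric.

(** * Valued fields and the p-adic numbers *)

Lemma vabs_nbhsP (R : realType) (L : valuedFieldType R) (x : L) (P : set L) :
  nbhs x P <-> exists2 e, 0 < e & forall y, vabs (x - y) < e -> P y.
Proof.
rewrite -nbhs_entourageE vabs_entourage; split.
  move=> [E [e /= e0 eE] EP]; exists e => // y xy.
  by apply: EP; apply/xsectionP; apply: eE.
move=> [e e0 eP]; exists [set xy | vabs (xy.1 - xy.2) < e]; first by exists e.
by move=> y /xsectionP; exact: eP.
Qed.

Lemma dense_approx (R : realType) (L : valuedFieldType R) (D : set L) x e :
  dense D -> 0 < e -> exists2 y, D y & vabs (x - y) < e.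
Proof.
move=> dD e0; pose B := [set y | vabs (x - y) < e].
have Bx : (B°)%classic x by apply/vabs_nbhsP; exists e.
have [|y [By Dy]] := dD (B°)%classic _ (@open_interior _ B); first by exists x.
by exists y => //; exact: interior_subset By.
Qed.

Section Padic.
Variables (R : realType) (p : nat) (p_prime : prime p).
Variables (Qp : completeValuedFieldType R).
Hypothesis hQp : is_completion (padic_abs R p) (ratr : rat -> Qp).

Let a0 := @vabs_absolute_value R Qp.

Lemma pR_gt0 : 0 < p%:R :> R.
Proof. by rewrite ltr0n prime_gt0. Qed.

Lemma pR_gt1 : 1 < p%:R :> R.
Proof. by rewrite ltr1n prime_gt1. Qed.

Lemma ler_pVX (i j : nat) : (p%:R ^- i <= p%:R ^- j :> R) = (j <= i)%N.
Proof. by rewrite lef_pV2 ?posrE ?exprn_gt0 ?pR_gt0 // ler_eXn2l ?pR_gt1. Qed.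

Lemma vabs_padic_nat (m : nat) :
  (0 < m)%N -> vabs (m%:R : Qp) = p%:R ^- logn p m.
Proof.
move=> m0; case: hQp => h _; rewrite -(ratr_nat Qp m) h /padic_abs.
rewrite pnatr_eq0 (gtn_eqF m0) -[m%:R]/(m%:Z%:~R) numq_int denq_int logn1 expr0.
by rewrite mul1r.
Qed.

Lemma vabs_padic_nat_le (j m : nat) :
  (vabs (m%:R : Qp) <= p%:R ^- j) = (p ^ j %| m)%N.
Proof.
have [->|m0] := posnP m.
  by rewrite (abs0 a0) dvdn0 invr_ge0 exprn_ge0 // ltW // pR_gt0.
by rewrite vabs_padic_nat // ler_pVX pfactor_dvdn.
Qed.

Lemma vabs_padic_nat_le1 (m : nat) : vabs (m%:R : Qp) <= 1.
Proof. by have := vabs_padic_nat_le 0 m; rewrite expr0 invr1 expn0 dvd1n. Qed.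

Lemma vabs_padic_coprime (m : nat) : coprime p m -> vabs (m%:R : Qp) = 1.
Proof.
have [->|m0 pm] := posnP m.
  by rewrite /coprime gcdn0 => /eqP p1; move: p_prime; rewrite p1.
by rewrite vabs_padic_nat // logn_coprime // expr0 invr1.
Qed.

Lemma padic_ultrametric : ultrametric (@vabs R Qp).
Proof. by apply: ultrametric_of_nat a0 vabs_padic_nat_le1. Qed.

Lemma vabs_padic_int_le1 (z : int) : vabs (z%:~R : Qp) <= 1.
Proof.
by case: z => m; rewrite ?NegzE ?mulrNz ?(absN a0) vabs_padic_nat_le1.
Qed.

Lemma vabs_padic_p : vabs (p%:R : Qp) = p%:R^-1.
Proof. by rewrite vabs_padic_nat ?prime_gt0 // logn_prime // eqxx expr1. Qed.

Lemma padic_digit_uniq (j c c' : nat) : (c < p ^ j)%N -> (c' < p ^ j)%N ->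
  vabs (c%:R - c'%:R : Qp) <= p%:R ^- j -> c = c'.
Proof.
wlog le_cc' : c c' / (c' <= c)%N => [h|cj c'j].
  have [|/ltnW] := leqP c' c; first exact: h.
  by move=> cc' cj c'j; rewrite (absB a0) => /h <-.
rewrite -natrB // vabs_padic_nat_le => /dvdn_leq h.
apply/eqP; rewrite eqn_leq le_cc' andbT -subn_eq0.
case: posnP h => // d0 /(_ isT); rewrite leqNgt ltn_subLR //.
by rewrite ltn_addl.
Qed.

(** The rational numbers are dense, and the denominator of a p-integral
    rational number is invertible modulo p ^ j. *)
Lemma padic_digit (x : Qp) (j : nat) : vabs x <= 1 ->
  exists2 c : nat, (c < p ^ j)%N & vabs (x - c%:R) <= p%:R ^- j.
Proof.
move=> x1; have hu := padic_ultrametric; case: (hQp) => hv hd.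
have pj0 : 0 < p%:R ^- j :> R by rewrite invr_gt0 exprn_gt0 ?pR_gt0.
have pj1 : p%:R ^- j <= 1 :> R.
  by rewrite -[leRHS]invr1 -(expr0 (p%:R : R)) ler_pVX.
have [_ [r _ <-] xr] := dense_approx x hd pj0.
have r1 : vabs (ratr r : Qp) <= 1.
  rewrite -[ratr r](subrK x) (abs_leD hu) //.
  by rewrite (absB a0) (le_trans (ltW xr)).
pose w := `|denq r|%N; have wE : denq r = w%:Z by rewrite /w absz_denq.
have w0 : w%:R != 0 :> Qp.
  rewrite -(abs_gt0 a0) vabs_padic_nat ?invr_gt0 ?exprn_gt0 ?pR_gt0 //.
  by rewrite absz_gt0 denq_neq0.
have rE : ratr r = (numq r)%:~R / w%:R :> Qp by rewrite /ratr wE.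
have pw : coprime p w.
  rewrite prime_coprime //; apply/negP => pw.
  have pn : ~~ (p %| `|numq r|)%N.
    have := coprime_num_den r; rewrite -/w => cnw.
    rewrite -prime_coprime // coprime_sym.
    by apply: coprime_dvdr pw cnw.
  have : vabs ((numq r)%:~R : Qp) = 1.
    have -> : vabs ((numq r)%:~R : Qp) = vabs (`|numq r|%N%:R : Qp).
      by case: (numq r) => m //; rewrite NegzE mulrNz (absN a0) abszN.
    by rewrite vabs_padic_coprime // prime_coprime.
  move: r1; rewrite rE (absM a0) (absV a0) => r1 n1.
  move: r1; rewrite n1 mul1r invf_le1 ?(abs_gt0 a0) // => r1.
  have := vabs_padic_nat_le 1 w; rewrite expn1 pw expr1 => h.
  by have := le_trans r1 h; rewrite leNgt invf_lt1 ?pR_gt0 ?pR_gt1.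
have w1 := vabs_padic_coprime pw.
have /coprimezP[[s t] /= st] : coprimez w (p ^ j)%N.
  by rewrite coprimezE /= coprimeXr // coprime_sym.
have pj_n0 : (p ^ j)%N%:Z != 0 :> int.
  by apply/eqP => -[]; apply/eqP; rewrite -lt0n expn_gt0 prime_gt0.
pose c0 := numq r * s; pose c := (c0 %% (p ^ j)%N)%Z.
have c_ge0 : 0 <= c by rewrite modz_ge0.
have cE : c = `|c|%N%:Z by rewrite gez0_abs.
exists `|c|%N; first by rewrite -ltz_nat -cE ltz_mod.
apply: (abs_le_trans hu (ltW xr)).
have -> : ratr r - `|c|%N%:R = (numq r - c * w)%:~R / w%:R :> Qp.
  by rewrite rE intrB intrM {2}cE mulrBl mulfK.
rewrite (absM a0) (absV a0) w1 invr1 mulr1.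
have -> : numq r - c * w = (numq r * t + (c0 %/ (p ^ j)%N)%Z * w) * (p ^ j)%N.
  have e0 := divz_eq c0 (p ^ j)%N; rewrite -/c in e0.
  have -> : c = c0 - (c0 %/ (p ^ j)%N)%Z * (p ^ j)%N by apply/eqP; rewrite eq_sym subr_eq addrC; apply/eqP.
  rewrite /c0 -{1}[numq r]mulr1 -st; ring.
rewrite intrM (absM a0) -[leRHS]mul1r ler_pM ?(abs_ge0 a0) ?vabs_padic_int_le1 //.
by rewrite vabs_padic_nat_le.
Qed.

End Padic.

(** * Orthonormal bases of unramified extensions *)

Lemma geometric_small (R : realType) (c z e : R) : 0 <= z < 1 -> 0 < e ->
  \forall m \near \oo, c * z ^+ m < e.
Proof.
move=> /andP[z0 z1] e0.
have /cvgrPdist_lt/(_ e e0) : geometric c z @ \oo --> (0 : R).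
  by apply: cvg_geometric; rewrite ger0_norm.
apply: filterS => m /=; rewrite sub0r normrN; apply: le_lt_trans.
exact: ler_norm.
Qed.

Lemma vabs_cauchy_seq (R : realType) (L : completeValuedFieldType R)
    (u : nat -> L) :
  (forall e, 0 < e -> \forall m \near \oo, forall l, (m <= l)%N ->
     vabs (u m - u l) < e) ->
  exists b : L, forall e, 0 < e -> \forall m \near \oo, vabs (b - u m) < e.
Proof.
move=> hc; have a0 := @vabs_absolute_value R L.
have [] := @vabs_complete R L (u @ \oo).
  move=> E; rewrite vabs_entourage => -[e /= e0 eE].
  have e20 : 0 < e / 2 by rewrite divr_gt0.
  have [m0 _ hm0] := hc _ e20.
  exists ([set u m | m in [set m | (m0 <= m)%N]],
          [set u m | m in [set m | (m0 <= m)%N]]) => /=.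
    by split; exists m0 => // m /= hm; exists m.
  move=> [_ _] [/= [m hm <-] [l hl <-]]; apply: eE => /=.
  have -> : u m - u l = (u m0 - u l) - (u m0 - u m).
    by rewrite opprB [RHS]addrC subrKA.
  case: a0 => _ _ _ /(_ (u m0 - u l) (- (u m0 - u m))) h.
  apply: (le_lt_trans h); rewrite (absN (@vabs_absolute_value R L)).
  by rewrite [e in _ < e]splitr ltrD // hm0 /=.
move=> b hb; exists b => e e0.
have : nbhs b [set y | vabs (b - y) < e] by apply/vabs_nbhsP; exists e.
exact: hb.
Qed.

(** The element w is a uniformizer, of absolute value 1 / t, both of Q and of M. *)
Section Orthonormal.
Variables (R : realType) (Q : completeValuedFieldType R).
Variables (M : fieldExtType Q) (N : M -> R) (t : R) (w : Q).
Hypotheses (hN : absolute_value N) (uN : ultrametric N).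
Hypothesis NQ : forall a : Q, N a%:A = vabs a.
Hypothesis t1 : 1 < t.
Hypothesis wt : vabs w = t^-1.
Hypothesis N_val : forall x, x != 0 -> exists k : int, N x = t ^ k.

Let t0 : 0 < t. Proof. exact: lt_trans ltr01 t1. Qed.

Lemma NZ a x : N (a *: x) = vabs a * N x.
Proof. by rewrite -[x in LHS]mul1r scalerAl (absM hN) NQ. Qed.

Let w0 : w != 0.
Proof. by rewrite -(abs_gt0 (@vabs_absolute_value R Q)) wt invr_gt0. Qed.

Lemma value_gap x y : N x < N y -> N x <= t^-1 * N y.
Proof.
have [->|x0] := eqVneq x 0.
  by rewrite (abs0 hN) => /ltW h; rewrite mulr_ge0 // invr_ge0 ltW.
have [->|y0] := eqVneq y 0; first by rewrite (abs0 hN) ltNge (abs_ge0 hN).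
have [k ->] := N_val x0; have [l ->] := N_val y0.
rewrite ltr_eXz2l // => kl.
by rewrite -exprN1 -expfzDr ?gt_eqF // ler_eXz2l // addrC lerBrDr lezD1.
Qed.

Lemma scale_to_unit x : x != 0 -> exists2 c : Q, c != 0 & N (c *: x) = 1.
Proof.
move=> x0; have [k hk] := N_val x0; exists (w ^ k); first exact: expfz_neq0.
have a0 := @vabs_absolute_value R Q.
have wX (l : int) : vabs (w ^ l) = t ^ (- l).
  case: l => m; first by rewrite -exprnP (absX a0) wt exprVn -exprnN.
  by rewrite NegzE opprK -exprnN (absV a0) (absX a0) wt exprVn invrK exprnP.
by rewrite NZ hk wX -expfzDr ?gt_eqF // addNr expr0z.
Qed.

(** The second clause is the lower half of the equality between the norm of a
    combination and the largest absolute value of its coefficients; the upper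
    half follows from the first clause.  Families are indexed by nat, and their
    first r members count, so that extending one does not change its type. *)
Definition orthonormal (r : nat) (e : nat -> M) : Prop :=
  (forall i, (i < r)%N -> N (e i) <= 1) /\
  (forall (a : nat -> Q) i, (i < r)%N ->
     vabs (a i) <= N (\sum_(j < r) a j *: e j)).

(** The coefficients of approximations of x form Cauchy sequences, because the
    norm of a combination bounds them, and their limits are those of x. *)
Lemma orthonormal_closed r e x c : orthonormal r e ->
  (forall m : nat, exists a : nat -> Q,
     N (x - \sum_(j < r) a j *: e j) <= c * t^-1 ^+ m) ->
  exists a : nat -> Q, x = \sum_(j < r) a j *: e j.
Proof.
move=> [e1 eo] /choice[A hA].
have ti : 0 <= t^-1 < 1 by rewrite invr_ge0 ltW //= invf_lt1.
have c0 : 0 <= c.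
  have := hA 0%N; rewrite expr0 mulr1; apply: le_trans.
  exact: (abs_ge0 hN).
have coord_cauchy m l i : (i < r)%N -> (m <= l)%N ->
    vabs (A m i - A l i) <= c * t^-1 ^+ m.
  move=> ir ml; apply: le_trans (eo (fun j => A m j - A l j) i ir) _.
  under eq_bigr do rewrite scalerBl.
  rewrite sumrB.
  have -> (u v : M) : u - v = (x - v) - (x - u) by rewrite opprB [RHS]addrC subrKA.
  apply: (abs_leB hN uN); last exact: hA.
  apply: le_trans (hA l) _; rewrite ler_wpM2l //.
  by case/andP: ti => ti0 ti1; rewrite ler_wiXn2l // ltW.
have lim i : exists b : Q, (i < r)%N -> forall d, 0 < d ->
    \forall m \near \oo, vabs (b - A m i) < d.
  have [ir|ri] := ltnP i r; last by exists 0.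
  have [|b hb] := @vabs_cauchy_seq R Q (fun m => A m i); last by exists b.
  move=> d d0; apply: filterS (geometric_small c ti d0) => m hm l ml.
  exact: le_lt_trans (coord_cauchy m l i ir ml) hm.
have {lim} [b hb] := choice lim; exists b.
apply/eqP; rewrite -subr_eq0 -(abs_eq0 hN) eq_le (abs_ge0 hN) andbT.
rewrite leNgt; apply/negP => d0; set d := N _ in d0.
have : \forall m \near \oo, forall i : 'I_r, vabs (b i - A m i) < d.
  by apply: filter_forall => i; exact: hb.
have near2 := geometric_small c ti d0.
move=> near1; have [m [h1 h2]] := filter_ex (filterI near1 near2).
suff : d < d by rewrite ltxx.
rewrite {1}/d.
have -> : x - \sum_(j < r) b j *: e j =
    (x - \sum_(j < r) A m j *: e j) + \sum_(j < r) (A m j - b j) *: e j.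
  under [X in _ = _ + X]eq_bigr do rewrite scalerBl.
  by rewrite sumrB addrA subrK.
apply: le_lt_trans (uN _ _) _; rewrite gt_max; apply/andP; split.
  exact: le_lt_trans (hA m) h2.
have a0 := @vabs_absolute_value R Q.
apply: (abs_lt_sum hN uN) => [|i _]; first exact: d0.
rewrite NZ (absB a0); apply: le_lt_trans (h1 i).
by rewrite -[leRHS]mulr1 ler_wpM2l ?(abs_ge0 a0) ?e1.
Qed.

(** A point outside the span has a best approximation in it: otherwise, values
    being discrete, repeated improvement by the factor t would give arbitrarily
    good approximations, and the span is closed.  Rescaled to norm one, the
    difference with the best approximation is the new vector. *)
Lemma orthonormal_extend r e x : orthonormal r e ->
  (forall a : nat -> Q, x <> \sum_(j < r) a j *: e j) ->
  exists y, orthonormal r.+1 (fun i => if (i < r)%N then e i else y).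
Proof.
move=> oe xe; have [e1 eo] := oe.
have [b bmin] : exists b : nat -> Q, forall a : nat -> Q,
    N (x - \sum_(j < r) b j *: e j) <= N (x - \sum_(j < r) a j *: e j).
  apply: contrapT => /forallNP nomin.
  have [m|a /xe//] := @orthonormal_closed r e x (N x) oe _.
  elim: m => [|m [a ha]].
    exists (fun=> 0); rewrite expr0 mulr1 big1 ?subr0 // => i _.
    by rewrite scale0r.
  have /existsNP[a' /negP] := nomin a; rewrite -ltNge => ha'.
  exists a'; apply: le_trans (value_gap ha') _.
  by rewrite exprS mulrCA ler_wpM2l // invr_ge0 ltW.
set z := x - _ in bmin.
have z0 : z != 0 by apply/eqP => /subr0_eq /xe.
have [c c0 cz] := scale_to_unit z0.
have a0 := @vabs_absolute_value R Q.
have far (a : nat -> Q) : 1 <= N (c *: z + \sum_(j < r) a j *: e j).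
  rewrite -cz.
  have -> : c *: z + \sum_(j < r) a j *: e j =
      c *: (x - \sum_(j < r) (b j - c^-1 * a j) *: e j).
    rewrite /z !scalerBr -addrA; congr (_ + _).
    under [in RHS]eq_bigr do rewrite scalerBl.
    rewrite sumrB scalerBr opprB addrC; congr (_ - _).
    by rewrite scaler_sumr; apply: eq_bigr => i _; rewrite scalerA mulrA mulfV ?mul1r.
  rewrite !NZ ler_wpM2l ?(abs_ge0 a0) //.
  exact: (bmin (fun j => b j - c^-1 * a j)).
exists (c *: z); split=> [i _|a i ir].
  by case: ifP => [/e1//|_]; rewrite cz.
have -> : \sum_(j < r.+1) a j *: (if (j < r)%N then e j else c *: z) =
    a r *: (c *: z) + \sum_(j < r) a j *: e j.
  rewrite big_ord_recr /= ltnn addrC; congr (_ + _).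
  by apply: eq_bigr => j _; rewrite ltn_ord.
set s := \sum_(j < r) _.
have ar : vabs (a r) <= N (a r *: (c *: z) + s).
  have [->|ar0] := eqVneq (a r) 0; first by rewrite (abs0 a0) abs_ge0.
  have -> : a r *: (c *: z) + s =
      a r *: (c *: z + \sum_(j < r) ((a r)^-1 * a j) *: e j).
    rewrite [RHS]scalerDr scaler_sumr; congr (_ + _); apply: eq_bigr => j _.
    by rewrite scalerA mulrA mulfV ?mul1r.
  by rewrite NZ -[leLHS]mulr1 ler_wpM2l ?(abs_ge0 a0) // (far (fun j => (a r)^-1 * a j)).
have [ir'|ri] := ltnP i r; last first.
  by have -> : i = r by apply/eqP; rewrite eqn_leq -ltnS ir.
have ai : vabs (a i) <= N s by exact: eo.
have [h|h] := leP (N s) (vabs (a r)); first exact: le_trans ai (le_trans h ar).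
by rewrite (abs_eqD hN uN) // NZ cz mulr1.
Qed.

(** The norm takes the same values on M as on Q, so that a vector can be rescaled
    to norm one; this is where being unramified enters. *)
Lemma orthonormal_basis : exists e : (\dim {:M}).-tuple M,
  [/\ basis_of {:M} e, forall i : 'I_(\dim {:M}), N e`_i <= 1 &
      forall x i, vabs (coord e i x) <= N x].
Proof.
have : forall r, (r <= \dim {:M})%N -> exists e, orthonormal r e.
  elim=> [_|r IH rd]; first by exists (fun=> 0).
  have [e oe] := IH (ltnW rd); pose V := <<[seq e i | i <- iota 0 r]>>%VS.
  have VC : vpick (V^C)%VS != 0.
    rewrite vpick0 -dimv_eq0 dimv_compl subn_eq0 -ltnNge.
    by apply: leq_ltn_trans (dim_span _) _; rewrite size_map size_iota.
  have [a|y oy] := @orthonormal_extend r e (vpick (V^C)%VS) oe; last first.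
    by exists (fun i => if (i < r)%N then e i else y).
  move=> hx; have : vpick (V^C)%VS \in (V :&: V^C)%VS.
    rewrite memv_cap memv_pick andbT hx; apply: memv_suml => i _.
    by apply/memvZ/memv_span/map_f; rewrite mem_iota ltn_ord.
  by rewrite capv_compl memv0 (negbTE VC).
move=> /(_ _ (leqnn _))[e [e1 eo]].
have sz : size [seq e i | i <- iota 0 (\dim {:M})] == \dim {:M}.
  by rewrite size_map size_iota.
have nthE (i : 'I_(\dim {:M})) : (Tuple sz)`_i = e i.
  by rewrite /= (nth_map 0%N) ?size_iota // nth_iota.
have a0 := @vabs_absolute_value R Q.
have eb : basis_of {:M} (Tuple sz).
  rewrite basisEfree subvf (eqP sz) leqnn !andbT; apply/freeP => k hk i.
  pose a (j : nat) := if insub j is Some j' then k j' else 0.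
  have aE (j : 'I_(\dim {:M})) : a j = k j by rewrite /a valK.
  have := eo a i (ltn_ord i); rewrite aE.
  have -> : \sum_(j < \dim {:M}) a j *: e j = 0.
    by rewrite -[RHS]hk; apply: eq_bigr => j _; rewrite aE nthE.
  by rewrite (abs0 hN) => h; apply/eqP; rewrite -(abs_eq0 a0) eq_le h abs_ge0.
exists (Tuple sz); split=> // [i|x i]; first by rewrite nthE e1.
pose a (j : nat) := if insub j is Some j' then coord (Tuple sz) j' x else 0.
have aE (j : 'I_(\dim {:M})) : a j = coord (Tuple sz) j x by rewrite /a valK.
have := eo a i (ltn_ord i); rewrite aE.
suff -> : \sum_(j < \dim {:M}) a j *: e j = x by [].
rewrite [RHS](coord_basis eb (memvf x)); apply: eq_bigr => j _.
by rewrite aE nthE.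
Qed.

End Orthonormal.

(** * The trace of an unramified extension *)

Lemma mxtrace_basis (Q : fieldType) (V : vectType Q)
    (e f : (\dim {:V}).-tuple V) (h : 'End(V)) :
  basis_of {:V} e -> basis_of {:V} f ->
  \tr (passmx.mxof e e h) = \sum_i coord f i (h f`_i).
Proof.
move=> eb fb.
have -> : \tr (passmx.mxof e e h) = \sum_i coord e i (h e`_i).
  apply: eq_bigr => i _; rewrite mxE /= mxE; congr (coord _ _ (h _)).
  rewrite /passmx.vecof (bigD1 i) //= mxE !eqxx scale1r big1 ?addr0 // => j ji.
  by rewrite mxE (negbTE ji) andbF scale0r.
transitivity (\sum_(i < \dim {:V}) \sum_(j < \dim {:V}) coord f j e`_i * coord e i (h f`_j)).
  apply: eq_bigr => i _; rewrite {1}(coord_basis fb (memvf e`_i)) !linear_sum.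
  by apply: eq_bigr => j _; rewrite !linearZ.
rewrite exchange_big; apply: eq_bigr => j _.
rewrite [in RHS](coord_basis eb (memvf (h f`_j))) linear_sum.
by apply: eq_bigr => i _; rewrite linearZ /= mulrC.
Qed.

Section UnramifiedTrace.
Variables (R : realType) (p : nat) (p_prime : prime p).
Variables (Qp : completeValuedFieldType R).
Hypothesis hQp : is_completion (padic_abs R p) (ratr : rat -> Qp).
Variables (M : fieldExtType Qp) (N : M -> R).
Hypotheses (hN : absolute_value N) (uN : ultrametric N).
Hypothesis NQ : forall a : Qp, N a%:A = vabs a.
Let d := \dim {:M}.
Variable e : d.-tuple M.
Hypotheses (eb : basis_of {:M} e) (e1 : forall i : 'I_d, N e`_i <= 1).
Hypothesis eo : forall x i, vabs (coord e i x) <= N x.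

Let a0 := @vabs_absolute_value R Qp.
Let uQ := padic_ultrametric p_prime hQp.
Let pR0 := pR_gt0 R p_prime.
Let pj0 j : 0 <= p%:R ^- j :> R. Proof. by rewrite invr_ge0 exprn_ge0 ?ltW. Qed.

Definition field_trace (x : M) : Qp :=
  \tr (passmx.mxof (vbasis {:M}) (vbasis {:M}) (amulr x)).

Lemma field_traceE x : field_trace x = \sum_i coord e i (e`_i * x).
Proof.
rewrite /field_trace (mxtrace_basis _ (vbasisP _) eb).
by apply: eq_bigr => i _; rewrite lfunE.
Qed.

Lemma field_traceD x y : field_trace (x + y) = field_trace x + field_trace y.
Proof.
rewrite !field_traceE -big_split /=; apply: eq_bigr => i _.
by rewrite mulrDr linearD.
Qed.

Lemma field_traceZ a x : field_trace (a *: x) = a * field_trace x.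
Proof.
rewrite !field_traceE mulr_sumr; apply: eq_bigr => i _.
by rewrite -scalerAr linearZ.
Qed.

Lemma field_trace_le x : vabs (field_trace x) <= N x.
Proof.
rewrite field_traceE; apply: (abs_le_sum a0 uQ) => [|i _]; first exact: abs_ge0.
apply: le_trans (eo _ _) _; rewrite (absM hN) -[leRHS]mul1r.
by rewrite ler_wpM2r ?(abs_ge0 hN).
Qed.

Lemma N_basis (i : 'I_d) : N e`_i = 1.
Proof.
apply/eqP; rewrite eq_le e1 /=; apply: le_trans (eo e`_i i).
by rewrite coord_free ?(basis_free eb) // eqxx (abs1 a0).
Qed.

Definition residue j (c : {ffun 'I_d -> 'I_(p ^ j)}) : M :=
  \sum_i (c i)%:R *: e`_i.

Lemma coord_residue j c i : coord e i (@residue j c) = (c i)%:R.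
Proof.
rewrite linear_sum (bigD1 i) //= linearZ /= coord_free ?(basis_free eb) //.
rewrite eqxx mulr1 big1 ?addr0 // => k ki.
by rewrite linearZ /= coord_free ?(basis_free eb) // (negbTE ki) mulr0.
Qed.

Lemma N_residue j c : N (@residue j c) <= 1.
Proof.
apply: (abs_le_sum hN uN) => // i _; rewrite (NZ hN NQ) N_basis mulr1.
exact: (vabs_padic_nat_le1 p_prime hQp).
Qed.

Lemma residue_inj j c c' : N (@residue j c - residue c') <= p%:R ^- j -> c = c'.
Proof.
move=> h; apply/ffunP => i; apply/val_inj.
apply: (padic_digit_uniq p_prime hQp (ltn_ord _) (ltn_ord _)).
by rewrite -!coord_residue -linearB; exact: le_trans (eo _ _) h.
Qed.

Lemma residue_ex j x : N x <= 1 -> exists c, N (x - @residue j c) <= p%:R ^- j.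
Proof.
move=> x1; have /choice[c hc] : forall i : 'I_d, exists c : 'I_(p ^ j),
    vabs (coord e i x - c%:R) <= p%:R ^- j.
  move=> i; have := le_trans (eo x i) x1.
  by move=> /(padic_digit p_prime hQp j)[c cj hc]; exists (Ordinal cj).
exists [ffun i => c i]; rewrite {1}(coord_basis eb (memvf x)) -sumrB.
apply: (abs_le_sum hN uN) => // i _.
by rewrite -scalerBl (NZ hN NQ) N_basis mulr1 ffunE.
Qed.

(** Let b run through representatives of the nonzero residue classes, and let l
    be a coordinate functional with l 1 a unit.  The operator
    x |-> \sum_b l (b x) b^-1 averages x |-> l x over the residue units, so
    modulo p it commutes with multiplications: it is the multiplication by its
    value z at 1.  Each of its summands has rank one and trace l (b b^-1), so
    its trace is (p ^ d - 1) l 1, which is a unit. *)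
Lemma unit_trace : exists2 z, N z <= 1 & vabs (field_trace z) = 1.
Proof.
have [i0 l1] : exists i0, vabs (coord e i0 1) = 1.
  apply: contrapT => /forallNP h; suff : N 1 < 1 by rewrite (abs1 hN) ltxx.
  rewrite {1}(coord_basis eb (memvf 1)); apply: (abs_lt_sum hN uN) => // i _.
  rewrite (NZ hN NQ) N_basis mulr1 lt_neqAle; apply/andP; split; first exact/eqP.
  by rewrite -[leRHS](abs1 hN).
have pp1 : p%:R ^- 1 < 1 :> R by rewrite invf_lt1 ?pR_gt1 // pR0.
have zp : (0 < p ^ 1)%N by rewrite expn1 prime_gt0.
pose c0 : {ffun 'I_d -> 'I_(p ^ 1)} := [ffun => Ordinal zp].
have res0 : residue c0 = 0.
  by rewrite /residue big1 // => i _; rewrite ffunE scale0r.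
have resU c : c != c0 -> N (residue c) = 1.
  move=> cc0; apply/eqP; rewrite eq_le N_residue /= leNgt; apply/negP => h.
  move/eqP: cc0; apply; apply/ffunP => i; apply/val_inj.
  rewrite /c0 ffunE /=; apply/eqP/negPn/negP => ci.
  have := le_lt_trans (eo (residue c) i) h; rewrite coord_residue.
  rewrite (vabs_padic_coprime p_prime hQp) ?ltxx //.
  rewrite prime_coprime //; apply/negP => /dvdn_leq; rewrite lt0n => /(_ ci).
  by rewrite leqNgt -[X in (_ < X)%N]expn1 ltn_ord.
pose l := coord e i0; pose av x :=
  \sum_(c : {ffun 'I_d -> 'I_(p ^ 1)} | c != c0) l (residue c * x) *: (residue c)^-1.
have lB x y : l (x - y) = l x - l y by exact: linearB.
have lM x : vabs (l x) <= N x by exact: eo.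
have av1 : N (av 1) <= 1.
  apply: (abs_le_sum hN uN) => // c cc0.
  rewrite (NZ hN NQ) (absV hN) resU // invr1 mulr1 mulr1.
  by apply: le_trans (lM _) _; rewrite resU.
have avE x : N x = 1 -> N (x * av 1 - av x) <= p%:R ^- 1.
  move=> x1; have x0 : x != 0 by rewrite -(abs_gt0 hN) x1.
  have /choice[s hs] : forall c : {ffun 'I_d -> 'I_(p ^ 1)}, exists c',
      N (residue c * x - @residue 1 c') <= p%:R ^- 1.
    by move=> c; apply: residue_ex; rewrite (absM hN) x1 mulr1 N_residue.
  have s_inj : injective s.
    move=> c c' ss; apply: residue_inj.
    rewrite -[N _]mulr1 -{1}x1 -(absM hN) mulrBl.
    apply: (abs_le_trans uN (hs c)); rewrite ss (absB hN); exact: hs.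
  have s0 c : (s c == c0) = (c == c0).
    have h : s c0 = c0.
      apply: residue_inj; rewrite (absB hN); have := hs c0.
      by rewrite res0 mul0r.
    by apply/eqP/eqP => [|->//]; rewrite -{1}h => /s_inj.
  rewrite /av (reindex_inj s_inj) /= mulr_sumr.
  rewrite (eq_bigl (fun c => c != c0)) => [|c]; last by rewrite /= s0.
  rewrite -sumrB; apply: (abs_le_sum hN uN) => // c cc0.
  have sc0 : s c != c0 by rewrite s0.
  have b0 : residue c != 0 by rewrite -(abs_gt0 hN) resU.
  have b'0 : residue (s c) != 0 by rewrite -(abs_gt0 hN) resU.
  rewrite mulr1 -scalerAr.
  have -> : l (residue (s c)) *: (x / residue (s c)) -
      l (residue c * x) *: (residue c)^-1 =
      l (residue (s c)) *: (x / residue (s c) - (residue c)^-1)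
      + l (residue (s c) - residue c * x) *: (residue c)^-1.
    by rewrite scalerBr lB scalerBl addrA subrK.
  apply: (abs_leD uN); last first.
    rewrite (NZ hN NQ) (absV hN) resU // invr1 mulr1.
    by apply: le_trans (lM _) _; rewrite (absB hN).
  have -> : x / residue (s c) - (residue c)^-1 =
      (residue c * x - residue (s c)) * ((residue c)^-1 * (residue (s c))^-1).
    by field; rewrite b0 b'0.
  rewrite (NZ hN NQ) !(absM hN) !(absV hN) !resU // invr1 !mulr1.
  rewrite -[leRHS]mul1r ler_pM ?(abs_ge0 a0) ?(abs_ge0 hN) //.
  by apply: le_trans (lM _) _; rewrite resU.
exists (av 1) => //.
have trE : \sum_i coord e i (av e`_i) = (p ^ d).-1%:R * l 1.
  transitivity (\sum_(c : {ffun 'I_d -> 'I_(p ^ 1)} | c != c0) l 1).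
    under eq_bigr do rewrite linear_sum.
    rewrite exchange_big; apply: eq_bigr => c cc0.
    have b0 : residue c != 0 by rewrite -(abs_gt0 hN) resU.
    rewrite -(mulfV b0) {2}(coord_basis eb (memvf (residue c)^-1)).
    rewrite mulr_sumr /l linear_sum; apply: eq_bigr => i _.
    by rewrite linearZ /= -scalerAr linearZ /= mulrC.
  rewrite sumr_const mulr_natl; congr (_ *+ _).
  by rewrite (cardC1 c0) card_ffun !card_ord expn1.
have d0 : (0 < d)%N.
  rewrite lt0n dimv_eq0; apply/eqP => V0; have := memvf (1 : M).
  by rewrite V0 memv0 oner_eq0.
have q1 : vabs ((p ^ d).-1%:R * l 1) = 1.
  rewrite (absM a0) l1 mulr1 (vabs_padic_coprime p_prime hQp) //.
  rewrite -(coprime_pexpl _ _ d0) coprimenP //.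
  by rewrite expn_gt0 prime_gt0.
rewrite -q1 -trE; apply: (abs_eq_of_close a0 uQ); rewrite trE q1.
apply: le_lt_trans pp1; rewrite -trE field_traceE -sumrB.
apply: (abs_le_sum a0 uQ) => // i _; rewrite -linearB.
by apply: le_trans (eo _ _) _; apply: avE; exact: N_basis.
Qed.

End UnramifiedTrace.

(** * Rational numbers in a field of characteristic zero *)

Section RatrChar0.
Variable F : fieldType.
Hypothesis F0 : forall m : nat, m%:R = 0 :> F -> m = 0%N.

Lemma intr_char0_neq0 (z : int) : z != 0 -> z%:~R != 0 :> F.
Proof.
apply: contraNN => /eqP h; rewrite -absz_eq0; apply/eqP/F0.
by case: z h => m //; rewrite NegzE mulrNz abszN => /eqP; rewrite oppr_eq0 => /eqP.
Qed.

Lemma ratr_char0_div (a b : int) :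
  b != 0 -> ratr (a%:~R / b%:~R) = a%:~R / b%:~R :> F.
Proof.
move=> b0; set q : rat := _ / _; rewrite /ratr.
have e : numq q * b = a * denq q.
  apply/eqP; rewrite -(eqr_int rat) !intrM.
  rewrite -[in X in X == _](divfK (x := (denq q)%:~R) _ (numq q)%:~R) ?intr_eq0 ?denq_neq0 //.
  by rewrite divq_num_den mulrAC /q divfK ?intr_eq0.
apply/eqP; rewrite eqr_div ?intr_char0_neq0 ?denq_neq0 //.
by rewrite -!intrM e mulrC.
Qed.

(** The p-adic numbers carry no order, so that the compatibility of ratr with the
    operations has to come from the characteristic. *)
Lemma ratr_char0_morph : exists f : {rmorphism rat -> F}, forall q, f q = ratr q.
Proof.
have zm : zmod_morphism (ratr : rat -> F).
  move=> x y; have dx := denq_neq0 x; have dy := denq_neq0 y.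
  have -> : x - y = (numq x * denq y - numq y * denq x)%:~R
                    / (denq x * denq y)%:~R.
    rewrite -{1}[x]divq_num_den -{1}[y]divq_num_den intrB !intrM.
    by field; rewrite !intr_eq0 dx dy.
  rewrite ratr_char0_div ?mulf_neq0 // intrB !intrM /ratr.
  by field; rewrite !intr_char0_neq0.
have mm : monoid_morphism (ratr : rat -> F).
  split=> [|x y]; first by rewrite -[1]/(1%:R) ratr_nat.
  have dx := denq_neq0 x; have dy := denq_neq0 y.
  have -> : x * y = (numq x * numq y)%:~R / (denq x * denq y)%:~R.
    rewrite -{1}[x]divq_num_den -{1}[y]divq_num_den !intrM.
    by field; rewrite !intr_eq0 dx dy.
  rewrite ratr_char0_div ?mulf_neq0 // !intrM /ratr.
  by field; rewrite !intr_char0_neq0.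
pose zM := GRing.isZmodMorphism.Build rat F (ratr : rat -> F) zm.
pose mM := GRing.isMonoidMorphism.Build rat F (ratr : rat -> F) mm.
pose f : {rmorphism rat -> F} := HB.pack (ratr : rat -> F) zM mM.
by exists f.
Qed.

End RatrChar0.

(** * The additive character *)

Section Circle.
Variable R : realType.

(** This is exp (- 2 pi i r). *)
Definition circle (r : R) : R[i] := cexp (0 +i* (- (2 * pi * r))).

Lemma circleE r : circle r = cos (2 * pi * r) +i* (- sin (2 * pi * r)).
Proof. by rewrite /circle /cexp /= expR0 mul1r cosN sinN. Qed.

Lemma circleD r s : circle (r + s) = circle r * circle s.
Proof.
rewrite !circleE mulrDr cosD sinD; apply/eqP; rewrite eq_complex /=.
by apply/andP; split; apply/eqP; ring.
Qed.

Lemma circle0 : circle 0 = 1.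
Proof. by rewrite circleE mulr0 cos0 sin0 oppr0. Qed.

Lemma circle_nat (m : nat) : circle m%:R = 1.
Proof.
elim: m => [|m IH]; first exact: circle0.
rewrite -natr1 circleD IH mul1r circleE mulr1.
by rewrite mulr_natl cos2pi sin2pi oppr0.
Qed.

Lemma circle_int (m : int) : circle m%:~R = 1.
Proof.
case: m => m; first exact: circle_nat.
rewrite NegzE mulrNz -[LHS]mulr1 -[X in _ * X](circle_nat m.+1) -circleD.
by rewrite addNr circle0.
Qed.

Lemma circle_eq1 (r : R) : circle r = 1 -> exists m : int, r = m%:~R.
Proof.
move=> hr; pose m := Num.floor r; exists m; pose f := r - m%:~R.
have [f0 f1] : 0 <= f /\ f < 1.
  by have /andP[] := floor_itv r; rewrite /f subr_ge0 ltrBlDl intrD => -> ->.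
have hf : circle f = 1.
  by rewrite /f circleD hr mul1r -mulrNz circle_int.
have /eqP : cos (2 * pi * f) = 1 by move: hf; rewrite circleE => -[].
have -> : 2 * pi * f = pi * f + pi * f by ring.
rewrite cosD => /eqP h; have h' := cos2Dsin2 (pi * f).
have /eqP : sin (pi * f) ^+ 2 = 0 by rewrite expr2; nra.
rewrite sqrf_eq0 => /eqP s0.
apply/eqP; rewrite -subr_eq0 -/f; apply/negPn/negP => fn0.
have f_gt0 : 0 < f by rewrite lt_neqAle eq_sym fn0.
have : 0 < sin (pi * f).
  by apply: sin_gt0_pi; rewrite mulr_gt0 ?pi_gt0 //= -[ltRHS]mulr1 ltr_pM2l ?pi_gt0.
by rewrite s0 ltxx.
Qed.

End Circle.

Section AdditiveCharacter.
Variables (R : realType) (p : nat) (p_prime : prime p).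
Variables (Qp L : completeValuedFieldType R).
Hypothesis hQp : is_completion (padic_abs R p) (ratr : rat -> Qp).
Variables (M : fieldExtType Qp) (g : {rmorphism L -> M}).

Let a0 := @vabs_absolute_value R Qp.
Let uQ := padic_ultrametric p_prime hQp.
Let pR0 := pR_gt0 R p_prime.
Let vR := vabs_padic_nat_le p_prime hQp.

Let ratr_padic : exists f : {rmorphism rat -> Qp}, forall q, f q = ratr q.
Proof.
apply: ratr_char0_morph => m /eqP; rewrite -(abs_eq0 a0).
have [//|m0] := posnP m; rewrite (vabs_padic_nat hQp) //.
by rewrite invr_eq0 expf_eq0 gt_eqF ?andbF.
Qed.

Definition p_fraction (y : rat) : Prop :=
  exists k : nat, p%:R ^+ k * y \is a Num.int.

Lemma p_fractionD y z : p_fraction y -> p_fraction z -> p_fraction (y + z).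
Proof.
move=> [k hk] [l hl]; exists (k + l)%N; rewrite mulrDr rpredD //.
  by rewrite exprD mulrAC rpredM // rpredX // rpred_nat.
by rewrite exprD -mulrA rpredM // rpredX // rpred_nat.
Qed.

Lemma p_fractionN y : p_fraction y -> p_fraction (- y).
Proof. by move=> [k hk]; exists k; rewrite mulrN rpredN. Qed.

(** The numerator of y over p ^ k is divisible by p ^ k. *)
Lemma p_fraction_int y : p_fraction y -> vabs (ratr y : Qp) <= 1 ->
  exists m : int, y = m%:~R.
Proof.
move=> [k /intrP[z hz]] y1.
have zE : vabs (z%:~R : Qp) = vabs (`|z|%N%:R : Qp).
  by case: (z) => m //; rewrite NegzE mulrNz (absN a0) abszN.
have : vabs (z%:~R : Qp) <= p%:R ^- k.
  have [f fE] := ratr_padic; rewrite -(ratr_int Qp z) -hz -fE.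
  rewrite rmorphM rmorphXn rmorph_nat /= fE (absM a0) (absX a0).
  rewrite (vabs_padic_p p_prime hQp) exprVn -[leRHS]mulr1 ler_wpM2l //.
rewrite zE vR => /dvdnP[c hc].
have pk0 : p%:R ^+ k != 0 :> rat.
  by rewrite expf_neq0 // pnatr_eq0 -lt0n prime_gt0.
exists (sgz z * c); apply: (mulfI pk0); rewrite hz.
have -> : z%:~R = (sgz z)%:~R * (c%:R * p%:R ^+ k) :> rat.
  by rewrite -natrX -natrM -hc -[_%:R]/(_%:Z%:~R) -intrM -intEsg.
by rewrite intrM; ring.
Qed.

(** Scaled by a power p ^ k, t becomes integral, and its residue modulo p ^ k is
    an integer. *)
Lemma p_fraction_approx (t : Qp) :
  exists2 y, p_fraction y & vabs (t - ratr y) <= 1.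
Proof.
have [k hk] : exists k : nat, vabs t <= p%:R ^+ k.
  exists (Num.bound (vabs t)); apply/ltW.
  apply: lt_trans (archi_boundP (abs_ge0 a0 t)) _.
  by rewrite -natrX ltr_nat ltn_expl // prime_gt1.
have pQ0 : p%:R != 0 :> Qp.
  by rewrite -(abs_gt0 a0) (vabs_padic_p p_prime hQp) invr_gt0.
have pk0 : 0 < p%:R ^- k :> R by rewrite invr_gt0 exprn_gt0.
have vpk : vabs (p%:R ^+ k : Qp) = p%:R ^- k.
  by rewrite (absX a0) (vabs_padic_p p_prime hQp) exprVn.
have [|c _ hc] := padic_digit p_prime hQp (x := p%:R ^+ k * t) k.
  rewrite (absM a0) vpk mulrC ler_pdivrMr ?mul1r //.
  by rewrite exprn_gt0.
have pkq : p%:R ^+ k != 0 :> rat.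
  by rewrite expf_neq0 // pnatr_eq0 -lt0n prime_gt0.
exists (c%:R / p%:R ^+ k).
  by exists k; rewrite mulrC mulfVK // rpred_nat.
rewrite -(ler_pM2l pk0) mulr1 -{1}vpk -(absM a0) mulrBr.
have [f fE] := ratr_padic; rewrite -fE fmorph_div rmorphXn /= !rmorph_nat.
by rewrite [X in _ - X]mulrC mulfVK // expf_neq0.
Qed.

Lemma e_charP (x : L) : exists y, [/\ p_fraction y,
  vabs (trace_Qp g x - ratr y) <= 1 & e_char g p x = circle (ratr y)].
Proof.
rewrite /e_char; set A := [set y | _].
have [y yf yx] := p_fraction_approx (trace_Qp g x).
have [h1 h2] := @xgetPex _ (0 : rat) A (ex_intro A y (conj yf yx)).
by exists (xget 0 A).
Qed.

(** A p-fraction is determined up to an integer by its class modulo the p-adic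
    integers, which makes the choice in e_char harmless. *)
Lemma circle_p_fraction y z : p_fraction y -> p_fraction z ->
  vabs (ratr y - ratr z : Qp) <= 1 -> circle (ratr y : R) = circle (ratr z).
Proof.
move=> hy hz; have [f fE] := ratr_padic.
rewrite -!fE -rmorphB fE => /p_fraction_int; case=> [|m hm]; first by apply: p_fractionD => //; exact: p_fractionN.
rewrite -[y](subrK z) hm rmorphD /= circleD ratr_int circle_int.
by rewrite mul1r.
Qed.

Lemma e_charD x y : e_char g p (x + y) = e_char g p x * e_char g p y.
Proof.
have [a [ha xa ->]] := e_charP x; have [b [hb yb ->]] := e_charP y.
have [c [hc xyc ->]] := e_charP (x + y).
rewrite -circleD -rmorphD /=.
apply: circle_p_fraction => //; first exact: p_fractionD.
have -> : ratr c - ratr (a + b) =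
    (trace_Qp g x - ratr a) + (trace_Qp g y - ratr b)
    - (trace_Qp g (x + y) - ratr c).
  have -> : trace_Qp g (x + y) = trace_Qp g x + trace_Qp g y.
    by rewrite -(field_traceD (vbasisP {:M})) /trace_Qp rmorphD.
  by have [f fE] := ratr_padic; rewrite -!fE rmorphD /=; ring.
by apply: (abs_leB a0 uQ) => //; exact: (abs_leD uQ).
Qed.

Lemma e_char_eq1 x : e_char g p x = 1 <-> vabs (trace_Qp g x) <= 1.
Proof.
have [a [ha xa ->]] := e_charP x; split.
  move=> /circle_eq1[m hm].
  have aE : a = m%:~R.
    by apply: (fmorph_inj (ratr : {rmorphism rat -> R})); rewrite /= hm ratr_int.
  rewrite -[trace_Qp g x](subrK (ratr a)) (abs_leD uQ) // aE ratr_int.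
  exact: (vabs_padic_int_le1 p_prime hQp).
move=> x1; rewrite -(circle0 R) -(rmorph0 (ratr : {rmorphism rat -> R})).
apply: circle_p_fraction => //; first by exists 0%N; rewrite mulr0 rpred0.
have [f fE] := ratr_padic; rewrite -!fE rmorph0 subr0 fE -[ratr a](subrK (trace_Qp g x)) (abs_leD uQ) //.
by rewrite (absB a0).
Qed.

End AdditiveCharacter.

(** * Boxes in matrix spaces *)

Section Boxes.
Variables (R : realType) (L : completeValuedFieldType R).
Hypothesis uL : ultrametric (@vabs R L).
Variable n : nat.
Implicit Types (X Y Z A : 'M[L]_n) (r s : R).

Let a0 := @vabs_absolute_value R L.

Definition box r : set 'M[L]_n := [set X | forall i j, vabs (X i j) <= r].

Lemma box0 r : 0 <= r -> box r 0.
Proof. by move=> r0 i j; rewrite mxE (abs0 a0). Qed.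

Lemma boxD r X Y : box r X -> box r Y -> box r (X + Y).
Proof. by move=> hX hY i j; rewrite mxE (abs_leD uL). Qed.

Lemma boxN r X : box r (- X) <-> box r X.
Proof. by split=> h i j; have := h i j; rewrite mxE (absN a0). Qed.

Lemma boxB r X Y : box r X -> box r Y -> box r (X - Y).
Proof. by move=> hX hY; apply: boxD => //; apply/boxN. Qed.

Lemma box_sym r X Y : box r (X - Y) -> box r (Y - X).
Proof. by rewrite -opprB => /boxN. Qed.

Lemma box_trans r X Y Z : box r (X - Y) -> box r (Y - Z) -> box r (X - Z).
Proof. by move=> h1 h2; rewrite -(subrK Y X) -addrA; exact: boxD. Qed.

Lemma box_le r s X : r <= s -> box r X -> box s X.
Proof. by move=> rs h i j; exact: le_trans (h i j) rs. Qed.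

Lemma box_tr r X : box r X -> box r X^T.
Proof. by move=> h i j; rewrite mxE. Qed.

Lemma boxM r s X Y : 0 <= r -> 0 <= s -> box r X -> box s Y -> box (r * s) (X *m Y).
Proof.
move=> r0 s0 hX hY i j; rewrite mxE.
apply: (abs_le_sum a0 uL) => [|k _]; first exact: mulr_ge0.
by rewrite (absM a0) ler_pM ?(abs_ge0 a0).
Qed.

Lemma boxZ r c X : box r X -> box (vabs c * r) (c *: X).
Proof.
by move=> h i j; rewrite mxE (absM a0) ler_wpM2l ?(abs_ge0 a0).
Qed.

Lemma trace_box r X : 0 <= r -> box r X -> vabs (\tr X) <= r.
Proof. by move=> r0 h; apply: (abs_le_sum a0 uL). Qed.

Lemma open_box r X : 0 < r -> open [set Y | box r (Y - X)].
Proof.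
move=> r0; rewrite openE => Y hY.
exists (fun i j => [set y | vabs (Y i j - y) < r]).
  by move=> i j; apply/vabs_nbhsP; exists r.
move=> Z hZ; apply: box_trans hY; apply: box_sym => i j.
by rewrite !mxE; apply/ltW/hZ.
Qed.

Definition box_reps a b (C : finType) (rho : C -> 'M[L]_n) : Prop :=
  [/\ forall c, box a (rho c),
      forall X, box a X -> exists c, box b (X - rho c) &
      forall c c', box b (rho c - rho c') -> c = c'].

Definition box_invariant (T : Type) b (h : 'M[L]_n -> T) : Prop :=
  forall X Z, box b Z -> h (X + Z) = h X.

Lemma box_invariantE (T : Type) b (h : 'M[L]_n -> T) X Y :
  box_invariant b h -> box b (X - Y) -> h X = h Y.
Proof. by move=> hh hb; rewrite -(hh Y _ hb) addrC subrK. Qed.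

(** The map f permutes the cosets of box b in box a. *)
Lemma sum_box_reps_map (V : nmodType) a b (C : finType) (rho : C -> 'M[L]_n)
    (h : 'M[L]_n -> V) (f : 'M[L]_n -> 'M[L]_n) :
  box_reps a b rho -> box_invariant b h ->
  (forall X, box a X -> box a (f X)) ->
  (forall X Y, box b (f X - f Y) -> box b (X - Y)) ->
  \sum_c h (f (rho c)) = \sum_c h (rho c).
Proof.
move=> [ra rex rinj] hinv fa fb.
have /choice[s hs] : forall c, exists c', box b (f (rho c) - rho c').
  by move=> c; apply/rex/fa.
have s_inj : injective s.
  move=> c c' ss; apply/rinj/fb; apply: box_trans (hs c) _.
  by rewrite ss; exact: box_sym.
rewrite [RHS](reindex_inj s_inj); apply: eq_bigr => c _.
exact: box_invariantE hinv (hs c).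
Qed.

End Boxes.

(** * Integrals of step functions *)

Section Integrals.
Variables (d : measure_display) (T : measurableType d) (R : realType).
Variable mu : {measure set T -> \bar R}.

Lemma Rintegral_simple (D : set T) (C : finType) (A : C -> set T)
    (w : C -> R) (f : T -> R) :
  (forall c, measurable (A c)) -> (forall c, (mu (A c) < +oo)%E) ->
  (forall x, (f \_ D) x = \sum_c w c * \1_(A c) x) ->
  Rintegral mu D f = \sum_c w c * fine (mu (A c)).
Proof.
move=> mA fA fE; rewrite /Rintegral integral_mkcond.
have -> : (EFin \o f) \_ D = fun x => (\sum_c (w c * \1_(A c) x)%:E)%E.
  apply/funext => x; rewrite sumEFin -fE /patch /=.
  by case: ifP.
have intA c : mu.-integrable setT (fun x => (\1_(A c) x)%:E).
  apply/integrableP; split.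
    by apply/measurable_EFinP; exact: measurable_indic.
  under eq_integral do rewrite /= ger0_norm //.
  by rewrite integral_indic // setIT.
have fin c : mu (A c) \is a fin_num by rewrite ge0_fin_numE.
under eq_fun do under eq_bigr do rewrite EFinM.
rewrite integral_sum // => [|c]; last exact: integrableZl.
under eq_bigr do rewrite integralZl // integral_indic // setIT.
rewrite -sum_fine => [|c _]; last by rewrite fin_numM.
by apply: eq_bigr => c _; rewrite fineM.
Qed.

Lemma cintegral_simple (D : set T) (C : finType) (A : C -> set T)
    (w : C -> R[i]) (f : T -> R[i]) :
  (forall c, measurable (A c)) -> (forall c, (mu (A c) < +oo)%E) ->
  (forall x, D x -> f x = \sum_c w c * (\1_(A c) x)%:C) ->
  (forall x, ~ D x -> forall c, ~ A c x) ->
  cintegral mu D f = \sum_c w c * (fine (mu (A c)))%:C.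
Proof.
move=> mA fA fE DA.
have fE' x : f x *+ (x \in D) = \sum_c w c * (\1_(A c) x)%:C.
  case: (boolP (x \in D)) => [/set_mem /fE //|xD].
  rewrite mulr0n big1 // => c _; rewrite indicE (memNset (A := A c)) ?mulr0 //.
  by apply: DA => xD'; move/negP: xD; apply; exact: mem_set.
have ReM (z : R[i]) (r : R) : complex.Re (z * r%:C) = complex.Re z * r.
  by case: z => x y /=; rewrite mulr0 subr0.
have ImM (z : R[i]) (r : R) : complex.Im (z * r%:C) = complex.Im z * r.
  by case: z => x y /=; rewrite mulr0 add0r.
rewrite /cintegral (@Rintegral_simple D C A (fun c => complex.Re (w c))) //.
  rewrite (@Rintegral_simple D C A (fun c => complex.Im (w c))) //.
    apply/eqP; rewrite eq_complex /= !raddf_sum /=.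
    by apply/andP; split; apply/eqP/eq_bigr => c _; rewrite ?ReM ?ImM.
  move=> x; under eq_bigr do rewrite -ImM.
  by rewrite -raddf_sum -fE' /patch; case: ifP.
move=> x; under eq_bigr do rewrite -ReM.
by rewrite -raddf_sum -fE' /patch; case: ifP.
Qed.

End Integrals.

(** * Step functions on matrix spaces *)

(** Representatives of the integers modulo the j-th power of the maximal ideal,
    t being the inverse of the absolute value of a uniformizer.  Their number is
    required to be multiplicative in j, so that the volumes of the balls of
    radii t ^ m and t ^- m are inverse to each other. *)
Definition residue_systems (R : realType) (L : completeValuedFieldType R)
    (t : R) (q : nat) : Prop :=
  forall j : nat, exists (T : finType) (rho : T -> L),
    [/\ #|T| = (q ^ j)%N, forall c, vabs (rho c) <= 1,
        forall x, vabs x <= 1 -> exists c, vabs (x - rho c) <= t ^- j &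
        forall c c', vabs (rho c - rho c') <= t ^- j -> c = c'].

(** The character psi is trivial on the ring of integers O, and O is the largest
    O-submodule on which it is. *)
Definition unramified_character (R : realType) (L : completeValuedFieldType R)
    (psi : L -> R[i]) : Prop :=
  [/\ forall x y, psi (x + y) = psi x * psi y,
      forall x, vabs x <= 1 -> psi x = 1 &
      forall x, 1 < vabs x -> exists2 y, vabs y <= 1 & psi (x * y) <> 1].

Section StepFunctions.
Variables (R : realType) (L : completeValuedFieldType R).
Hypothesis uL : ultrametric (@vabs R L).
Variables (t : R) (w : L) (q n : nat).
Hypotheses (t1 : 1 < t) (wt : vabs w = t^-1).
Hypothesis res : residue_systems L t q.
Implicit Types X Y Z A : 'M[L]_n.

Let a0 := @vabs_absolute_value R L.

Let t0 : 0 < t. Proof. exact: lt_trans ltr01 t1. Qed.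
Let tX k : 0 < t ^+ k. Proof. exact: exprn_gt0. Qed.
Let tV k : 0 < t ^- k. Proof. by rewrite invr_gt0. Qed.
Let w0 : w != 0. Proof. by rewrite -(abs_gt0 a0) wt invr_gt0. Qed.

Lemma tV_le m k : (m <= k)%N -> t ^- k <= t ^- m.
Proof. by move=> mk; rewrite lef_pV2 ?posrE // ler_eXn2l. Qed.

Lemma tX_le m k : (m <= k)%N -> t ^+ m <= t ^+ k.
Proof. by move=> mk; rewrite ler_eXn2l. Qed.

Lemma box_reps_exist m k : exists (C : finType) (rho : C -> 'M[L]_n),
  #|C| = ((q ^ (n * n)) ^ (m + k))%N /\ box_reps (t ^+ m) (t ^- k) rho.
Proof.
have [T [rho [cardT rho1 rex rinj]]] := res (m + k).
exists 'M[T]_n, (fun c => w ^- m *: map_mx rho c); split.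
  by rewrite card_mx cardT -!expnM mulnC.
have wm0 : w ^+ m != 0 by rewrite expf_neq0.
have vwm : vabs (w ^+ m) = t ^- m by rewrite (absX a0) wt exprVn.
have vwV : vabs (w ^- m) = t ^+ m by rewrite (absV a0) vwm invrK.
have tmk : t ^+ m * t ^- (m + k) = t ^- k.
  by rewrite exprD invfM mulrA mulfV ?mul1r ?gt_eqF.
split=> [c|X hX|c c' h].
- rewrite -[t ^+ m]mulr1 -vwV; apply: boxZ => i j.
  by rewrite mxE.
- have hX1 i j : vabs ((w ^+ m *: X) i j) <= 1.
    by rewrite mxE (absM a0) vwm mulrC ler_pdivrMr ?mul1r.
  have /choice[c hc] : forall ij : 'I_n * 'I_n, exists c,
      vabs ((w ^+ m *: X) ij.1 ij.2 - rho c) <= t ^- (m + k).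
    by move=> ij; apply: rex.
  exists (\matrix_(i, j) c (i, j)) => i j.
  have -> : X - w ^- m *: map_mx rho (\matrix_(i, j) c (i, j)) =
      w ^- m *: (w ^+ m *: X - map_mx rho (\matrix_(i, j) c (i, j))).
    by rewrite scalerBr scalerA mulVf // scale1r.
  rewrite mxE (absM a0) vwV -tmk ler_pM2l //.
  by have := hc (i, j); rewrite !mxE.
- apply/matrixP => i j; apply: rinj.
  have := h i j; rewrite -scalerBr mxE (absM a0) vwV -tmk ler_pM2l //.
  by rewrite !mxE.
Qed.

Lemma box_exists X : exists m : nat, box (t ^+ m) X.
Proof.
have vb (x : L) : \forall m \near \oo, vabs x <= t ^+ m.
  have ti : 0 <= t^-1 < 1 by rewrite invr_ge0 ltW //= invf_lt1.
  apply: filterS (geometric_small (vabs x) ti ltr01) => m /=.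
  by rewrite exprVn ltr_pdivrMr // mul1r => /ltW.
have : \forall m \near \oo, forall ij : 'I_n * 'I_n, vabs (X ij.1 ij.2) <= t ^+ m.
  by apply: filter_forall => ij; exact: vb.
by move=> /filter_ex[m hm]; exists m => i j; exact: hm (i, j).
Qed.

(** One parameter bounds both the support and the scale of h, because the Fourier
    transform exchanges the two. *)
Definition step (m : nat) (h : 'M[L]_n -> R[i]) : Prop :=
  (forall X, ~ box (t ^+ m) X -> h X = 0) /\ box_invariant (t ^- m) h.

Lemma step_le m k h : (m <= k)%N -> step m h -> step k h.
Proof.
move=> mk [hs hi]; split=> [X hX|X Z hZ].
  by apply: hs => hX'; apply: hX; apply: box_le hX'; exact: tX_le.
by apply: hi; apply: box_le hZ; exact: tV_le.
Qed.

Variable mu : {measure set (borelM L n) -> \bar R}.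
Hypothesis hmu : additive_haar mu.

Lemma measurable_box X r : 0 < r ->
  measurable ([set Y | box r (Y - X)] : set (borelM L n)).
Proof. by move=> r0; apply: sub_sigma_algebra; exact: open_box. Qed.

Lemma mu_coset X r : 0 < r -> mu [set Y | box r (Y - X)] = mu (@box R L n r).
Proof.
move=> r0; case: hmu => hinv _.
have mb : measurable (@box R L n r : set (borelM L n)).
  by have := measurable_box 0 r0; under eq_set do rewrite subr0.
rewrite -(hinv X _ mb); congr (mu _); apply/seteqP; split=> Y /=.
  by move=> hY; exists (Y - X) => //; rewrite addrC subrK.
by move=> [Z hZ <-]; rewrite addrC addKr.
Qed.

Lemma mu_box_lty k : (mu (@box R L n (t ^- k)) < +oo)%E.
Proof.
have m1 : mu (@box R L n 1) = 1%E by case: hmu.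
have mb r : 0 < r -> measurable (@box R L n r : set (borelM L n)).
  by move=> r0; have := measurable_box 0 r0; under eq_set do rewrite subr0.
apply: (@le_lt_trans _ _ 1%E); last exact: ltry.
rewrite -m1 le_measure ?inE //; try exact: mb.
by move=> X; apply: box_le; rewrite -[leRHS]invr1 -(expr0 t) tV_le.
Qed.

Definition vol (k : nat) : R := fine (mu (@box R L n (t ^- k))).

(** The function is a combination of indicators of translates of one box. *)
Lemma cintegral_step a k (C : finType) (rho : C -> 'M[L]_n) (h : 'M[L]_n -> R[i]) :
  box_reps a (t ^- k) rho -> t ^- k <= a ->
  (forall X, ~ box a X -> h X = 0) -> box_invariant (t ^- k) h ->
  cintegral mu setT h = (vol k)%:C * \sum_c h (rho c).
Proof.
move=> [ra rex rinj] ka hs hi.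
pose A c : set (borelM L n) := [set Y | box (t ^- k) (Y - rho c)].
rewrite (@cintegral_simple _ _ _ mu setT C A (fun c => h (rho c))).
- by rewrite mulr_sumr; apply: eq_bigr => c _; rewrite mu_coset // mulrC.
- by move=> c; exact: measurable_box.
- by move=> c; rewrite mu_coset // mu_box_lty.
- move=> X _; have [hX|hX] := pselect (box a X).
    have [c hc] := rex X hX; rewrite (bigD1 c) //= indicE mem_set // mulr1.
    rewrite -(box_invariantE hi hc) big1 ?addr0 // => c' c'c.
    rewrite indicE memNset ?mulr0 // => hc'.
    move/eqP: c'c; apply; apply: rinj.
    by apply: (box_trans uL) hc; exact: box_sym.
  rewrite hs // big1 // => c _; rewrite indicE memNset ?mulr0 // => hc.
  apply: hX; rewrite -(subrK (rho c) X); apply: (boxD uL) => //.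
  exact: box_le hc.
- by move=> X; case.
Qed.

Lemma cintegral_stepE m (C : finType) (rho : C -> 'M[L]_n) h :
  box_reps (t ^+ m) (t ^- m) rho -> step m h ->
  cintegral mu setT h = (vol m)%:C * \sum_c h (rho c).
Proof.
move=> hrho [hs hi]; apply: cintegral_step hs hi => //.
apply: (@le_trans _ _ 1); first by rewrite -[leRHS]invr1 -(expr0 t) tV_le.
by rewrite -(expr0 t) tX_le.
Qed.

Lemma cintegral_stepZ m c h : step m h ->
  cintegral mu setT (fun X => c * h X) = c * cintegral mu setT h.
Proof.
move=> hh; have [C [rho [_ hrho]]] := box_reps_exist m m.
rewrite !(cintegral_stepE hrho) //; first by rewrite -mulr_sumr mulrCA.
by case: hh => hs hi; split=> [X /hs ->|X Z /hi ->] //; rewrite mulr0.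
Qed.

(** This makes the measure self-dual.  The unit box, of volume one, is a disjoint
    union of translates of the box of radius t ^- m: integrate its indicator. *)
Lemma vol_card m : vol m * ((q ^ (n * n)) ^ m)%:R = 1.
Proof.
have [C [rho [cardC hrho]]] := box_reps_exist 0 m.
have t_le1 : t ^- m <= t ^+ 0 by rewrite expr0 -[leRHS]invr1 -(expr0 t) tV_le.
have m1 : measurable (@box R L n 1 : set (borelM L n)).
  by have := measurable_box 0 ltr01; under eq_set do rewrite subr0.
pose h X : R[i] := (\1_(@box R L n 1) X)%:C.
have := @cintegral_step _ _ _ rho h hrho t_le1.
have -> : cintegral mu setT h = 1.
  rewrite (@cintegral_simple _ _ _ mu setT unit
    (fun=> @box R L n 1) (fun=> 1)) //.
  - by rewrite big_const card_unit /= mul1r addr0; case: hmu => _ ->.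
  - by move=> _; case: hmu => _ ->; exact: ltry.
  - by move=> X _; rewrite big_const card_unit /= mul1r addr0.
  - by move=> X; case.
have h1 c : h (rho c) = 1.
  by rewrite /h indicE mem_set //; case: hrho => + _ _; rewrite expr0; exact.
under eq_bigr do rewrite h1.
rewrite sumr_const cardC add0n => /(_ _ _)/esym H.
apply: (@complexI R); rewrite rmorphM rmorph_nat rmorph1 -[RHS]H //.
- move=> X; rewrite expr0 => hX; rewrite /h indicE memNset //.
- move=> X Z hZ; rewrite /h !indicE; congr ((nat_of_bool _)%:R%:C); apply/idP/idP => /set_mem hX.
    apply: mem_set; rewrite -(addrK Z X); apply: (boxB uL) => //.
    by apply: box_le hZ; rewrite expr0 in t_le1.
  by apply: mem_set; apply: (boxD uL) => //; apply: box_le hZ; rewrite expr0 in t_le1.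
Qed.

(** * Fourier inversion for step functions *)

Variable psi : L -> R[i].
Hypothesis hpsi : unramified_character psi.

Definition pairing A X : R[i] := psi (\tr (A *m X^T)).

Lemma pairingC A X : pairing A X = pairing X A.
Proof. by rewrite /pairing -mxtrace_tr trmx_mul trmxK. Qed.

Lemma pairingDr A X Y : pairing A (X + Y) = pairing A X * pairing A Y.
Proof. by case: hpsi => hD _ _; rewrite /pairing linearD mulmxDr linearD hD. Qed.

Lemma pairingDl A X Y : pairing (X + Y) A = pairing X A * pairing Y A.
Proof. by rewrite !(pairingC _ A) pairingDr. Qed.

Lemma pairing_triv m A X :
  box (t ^+ m) A -> box (t ^- m) X -> pairing A X = 1.
Proof.
case: hpsi => _ h1 _ hA hX; apply: h1; apply: (trace_box uL) => //.
rewrite -[X in box X](mulfV (x := t ^+ m)) ?gt_eqF //.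
by apply: (boxM uL) => //; [exact: ltW|exact: ltW|exact: box_tr].
Qed.

(** Some entry of A is too large, and a multiple of the matrix unit at that entry
    detects it. *)
Lemma pairing_nontriv (c : L) A : c != 0 -> ~ box (vabs c)^-1 A ->
  exists2 Z, box (vabs c) Z & pairing A Z <> 1.
Proof.
move=> c0 /existsNP[i /existsNP[j /negP]]; rewrite -ltNge => hA.
have vc : 0 < vabs c by rewrite (abs_gt0 a0).
case: hpsi => _ _ /(_ (A i j * c)) [|y y1 hy].
  by rewrite (absM a0) -ltr_pdivrMr // mul1r.
exists ((c * y) *: delta_mx i j).
  move=> k l; rewrite !mxE !(absM a0) -mulrA -[leRHS]mulr1 ler_pM2l //.
  case: (_ && _); rewrite ?(abs1 a0) ?(abs0 a0) ?mulr1 ?mulr0 //.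
rewrite /pairing linearZ /= -scalemxAr trmx_delta linearZ /=.
suff -> : \tr (A *m delta_mx j i) = A i j by rewrite mulrC mulrA.
rewrite /mxtrace (bigD1 i) //= mxE (bigD1 j) //= mxE !eqxx mulr1.
rewrite [X in _ + X + _]big1 ?addr0 => [|k kj]; last first.
  by rewrite mxE (negbTE kj) mulr0.
rewrite big1 ?addr0 // => k ki; rewrite mxE big1 // => l _.
by rewrite mxE (negbTE ki) andbF mulr0.
Qed.

Let vabs_wX k : vabs (w ^+ k) = t ^- k.
Proof. by rewrite (absX a0) wt exprVn. Qed.

Let eq0_of_mul (z u : R[i]) : u <> 1 -> z * u = z -> z = 0.
Proof.
move=> u1 /eqP; rewrite -subr_eq0 -[X in _ - X]mulr1 -mulrBr mulf_eq0.
by rewrite subr_eq0 => /orP[/eqP//|/eqP].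
Qed.

(** A nontrivial character of a finite group sums to zero: translate the
    summation variable by an element where the character is not one. *)
Lemma sum_pairing m (C : finType) (rho : C -> 'M[L]_n) A :
  box_reps (t ^+ m) (t ^- m) rho -> box (t ^+ m) A -> ~ box (t ^- m) A ->
  \sum_c pairing A (rho c) = 0.
Proof.
move=> hrho hA hA'.
have wm0 : w ^- m != 0 by rewrite invr_eq0 expf_neq0.
have vw : vabs (w ^- m) = t ^+ m by rewrite (absV a0) vabs_wX invrK.
have [|Z hZ Z1] := pairing_nontriv (A := A) wm0; first by rewrite vw.
rewrite vw in hZ; apply: (eq0_of_mul Z1); rewrite mulr_suml.
under eq_bigr do rewrite -pairingDr.
apply: (sum_box_reps_map uL (f := fun X => X + Z) hrho).
- by move=> X Y hY; rewrite pairingDr (pairing_triv hA hY) mulr1.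
- by move=> X hX; exact: (boxD uL).
- by move=> X Y; rewrite opprD addrACA subrr addr0.
Qed.

Definition fourier (h : 'M[L]_n -> R[i]) (N : 'M[L]_n) : R[i] :=
  cintegral mu setT (fun Y => h Y * pairing Y N).

Lemma step_pairing m h N : step m h -> box (t ^+ m) N ->
  step m (fun Y => h Y * pairing Y N).
Proof.
move=> [hs hi] hN; split=> [X /hs ->|X Z hZ]; first by rewrite mul0r.
by rewrite hi // pairingDl [pairing Z N]pairingC (pairing_triv hN hZ) mulr1.
Qed.

Lemma fourier_sum m (C : finType) (rho : C -> 'M[L]_n) h N :
  box_reps (t ^+ m) (t ^- m) rho -> step m h -> box (t ^+ m) N ->
  fourier h N = (vol m)%:C * \sum_c h (rho c) * pairing (rho c) N.
Proof.
by move=> hrho hh hN; rewrite /fourier (cintegral_stepE hrho) //; exact: step_pairing.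
Qed.

(** Invariance of h under translations bounds the support of its transform:
    outside, some translation multiplies the sum by a number other than one.
    The support of h bounds the scale of its transform. *)
Lemma step_fourier m h : step m h -> step m (fourier h).
Proof.
move=> hh; split=> [N hN|N Z hZ]; last first.
  rewrite /fourier; congr (cintegral mu _ _); apply/funext => Y.
  have [hY|hY] := pselect (box (t ^+ m) Y).
    by rewrite pairingDr (pairing_triv hY hZ) mulr1.
  by case: hh => hs _; rewrite hs // !mul0r.
have [k' hk'] := box_exists N; pose k := maxn m k'.
have hk : box (t ^+ k) N by apply: box_le hk'; rewrite tX_le // leq_maxr.
have mk : (m <= k)%N by rewrite leq_maxl.
have [C [rho [_ hrho]]] := box_reps_exist k k.
have hhk := step_le mk hh; rewrite (fourier_sum hrho hhk hk).
have wm0 : w ^+ m != 0 by rewrite expf_neq0.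
have [|Z hZ Z1] := pairing_nontriv (A := N) wm0; first by rewrite vabs_wX invrK.
rewrite vabs_wX in hZ.
suff -> : \sum_c h (rho c) * pairing (rho c) N = 0 by rewrite mulr0.
apply: (eq0_of_mul Z1); rewrite mulr_suml.
have [_ hi] := hh.
under eq_bigr do rewrite -(hi _ _ hZ) -mulrA [pairing N Z]pairingC -pairingDl.
apply: (sum_box_reps_map uL (h := fun X => h X * pairing X N) (f := fun X => X + Z) hrho).
- by have [] := step_pairing hhk hk.
- move=> X hX; apply: (boxD uL) => //; apply: box_le hZ.
  by rewrite (@le_trans _ _ 1) // -?[leRHS]invr1 -(expr0 t) ?tV_le ?tX_le.
- by move=> X Y; rewrite opprD addrACA subrr addr0.
Qed.

(** The double sum over cosets collapses, by orthogonality, to the coset of B,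
    with the constant vol k ^ 2 * #|C|, which is one. *)
Lemma fourier_inversion m h B : step m h ->
  cintegral mu setT (fun N => fourier h N * pairing (- B) N) = h B.
Proof.
move=> hh0; have [k' hk'] := box_exists B; pose k := maxn m k'.
have hB : box (t ^+ k) B by apply: box_le hk'; rewrite tX_le // leq_maxr.
have hh : step k h by apply: step_le hh0; rewrite leq_maxl.
have [C [rho [cardC hrho]]] := box_reps_exist k k.
have [ra rex rinj] := hrho; have [_ hi] := hh.
have st : step k (fun N => fourier h N * pairing N (- B)).
  by apply: step_pairing; [exact: step_fourier|exact/boxN].
under [X in cintegral _ _ X]eq_fun do rewrite pairingC.
rewrite (cintegral_stepE hrho st).
under eq_bigr do rewrite (fourier_sum hrho hh) // -mulrA mulr_suml.
rewrite -mulr_sumr exchange_big /=.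
have inner c : \sum_c' h (rho c) * pairing (rho c) (rho c') * pairing (rho c') (- B)
    = h (rho c) * \sum_c' pairing (rho c - B) (rho c').
  rewrite mulr_sumr; apply: eq_bigr => c' _.
  by rewrite -mulrA [pairing _ (- B)]pairingC -pairingDl.
under eq_bigr do rewrite inner.
have [c0 hc0] := rex B hB.
rewrite (bigD1 c0) //= [X in _ + X]big1 ?addr0 => [|c cc0]; last first.
  rewrite (sum_pairing hrho) ?mulr0 //; first exact: (boxB uL).
  move=> hc; move/eqP: cc0; apply; apply: rinj.
  exact: (box_trans uL) hc hc0.
rewrite (eq_bigr (fun=> 1)) => [|c _]; last first.
  by rewrite pairingC (pairing_triv (ra c)) //; exact: box_sym.
rewrite sumr_const cardC -(box_invariantE hi hc0).
have := congr1 (fun x : R => x%:C) (vol_card k); rewrite rmorphM rmorph_nat rmorph1 => vk.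
rewrite expnD natrM.
set Q := (_ ^ k)%:R in vk *.
rewrite -[RHS]mulr1 -[X in _ = _ * X]mul1r -{1}vk -vk; ring.
Qed.

(** An integral matrix with integral inverse permutes the cosets of each box. *)
Lemma cintegral_step_mulmx m h A : step m h -> box 1 A -> box 1 (invmx A) ->
  A \in unitmx -> cintegral mu setT (fun Y => h (A *m Y)) = cintegral mu setT h.
Proof.
move=> hh A1 AV1 Au; have [C [rho [_ hrho]]] := box_reps_exist m m.
have hA r X : 0 <= r -> box r X -> box r (A *m X).
  by move=> r0 hX; rewrite -[r]mul1r; exact: (boxM uL).
have hAV r X : 0 <= r -> box r (A *m X) -> box r X.
  by move=> r0 hX; rewrite -(mulKmx Au X) -[r]mul1r; exact: (boxM uL).
have st : step m (fun Y => h (A *m Y)).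
  case: hh => hs hi; split=> [X hX|X Z hZ].
    by apply: hs => /(hAV _ _ (ltW (tX m))).
  by rewrite mulmxDr hi //; apply: hA => //; exact: ltW.
rewrite (cintegral_stepE hrho hh) (cintegral_stepE hrho st); congr (_ * _).
apply: (sum_box_reps_map uL (f := fun X => A *m X) hrho).
- by case: hh.
- by move=> X; apply: hA; exact: ltW.
- by move=> X Y; rewrite -mulmxBr => /hAV; apply; exact: ltW.
Qed.

End StepFunctions.

(** * Locally constant functions with compact support *)

Section LocallyConstant.
Variables (R : realType) (L : completeValuedFieldType R).
Hypothesis uL : ultrametric (@vabs R L).
Variables (t : R) (n : nat).
Hypothesis t1 : 1 < t.

Let ti : 0 <= t^-1 < 1.
Proof. by rewrite invr_ge0 (le_trans ler01 (ltW t1)) /= invf_lt1 // (lt_trans ltr01). Qed.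

Lemma nbhs_box (X : 'M[L]_n) (P : set 'M[L]_n) : nbhs X P ->
  exists k : nat, forall Z, box (t ^- k) Z -> P (X + Z).
Proof.
move=> [Q hQ QP].
have : \forall m \near \oo, forall ij : 'I_n * 'I_n,
    forall y, vabs (X ij.1 ij.2 - y) <= t ^- m -> Q ij.1 ij.2 y.
  apply: filter_forall => -[i j] /=.
  have /vabs_nbhsP[e e0 he] := hQ i j.
  apply: filterS (geometric_small 1 ti e0) => m hm y hy; apply: he.
  by apply: le_lt_trans hy _; rewrite -exprVn -[ltLHS]mul1r.
move=> /filter_ex[m hm]; exists m => Z hZ; apply: QP => i j.
apply: (hm (i, j)); rewrite mxE opprD addrA subrr add0r.
by rewrite (absN (@vabs_absolute_value R L)).
Qed.

(** For large m, h is invariant under the box of radius t ^- m near any given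
    point, hence uniformly on A by compactness; outside A it is invariant as well,
    since a translation back from A would be one from A. *)
Lemma step_of_locally_constant (h : 'M[L]_n -> R[i]) (A : set 'M[L]_n) :
  (forall X, \forall Y \near X, h Y = h X) -> compact A ->
  (forall X, ~ A X -> h X = 0) -> exists m, step t m h.
Proof.
move=> hloc cA hA; have t0 : 0 < t := lt_trans ltr01 t1.
pose P (m : nat) X := box (t ^+ m) X /\ forall Z, box (t ^- m) Z -> h (X + Z) = h X.
have : \forall m \near \oo, A `<=` P m.
  apply: ((compact_near_coveringP A).1 cA nat \oo P _) => X _.
  have [k1 hk1] := box_exists t1 X.
  have [k2 hk2] := nbhs_box (hloc X).
  pose k := maxn k1 k2.
  exists ([set Y | box (t ^- k) (Y - X)], [set m | (k <= m)%N]) => /=.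
    split; last by exists k.
    apply: open_nbhs_nbhs; split; first by apply: open_box; rewrite // invr_gt0 exprn_gt0.
    by rewrite /= subrr; apply: box0; rewrite invr_ge0 exprn_ge0 // ltW.
  move=> [Y m] /= [hY km].
  have k2m : (k2 <= m)%N by apply: leq_trans km; rewrite leq_maxr.
  have k2k : (k2 <= k)%N by rewrite leq_maxr.
  have hXY : h Y = h X.
    by rewrite -(hk2 (Y - X)) ?[X + _]addrC ?subrK //; apply: box_le hY; exact: tV_le.
  split.
    rewrite -(subrK X Y); apply: (boxD uL).
      apply: box_le hY; apply: (@le_trans _ _ 1).
        by rewrite -[leRHS]invr1 -(expr0 t) tV_le.
      by rewrite -(expr0 t) tX_le.
    by apply: box_le hk1; rewrite tX_le // (leq_trans _ km) // leq_maxl.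
  move=> Z hZ; rewrite hXY -(hk2 (Y - X + Z)).
    by rewrite addrA [X + _]addrC subrK.
  apply: (boxD uL); first by apply: box_le hY; exact: tV_le.
  by apply: box_le hZ; exact: tV_le.
move=> /filter_ex[m hm]; exists m; split=> [X hX|X Z hZ].
  by apply: hA => /hm[].
have [AX|nAX] := pselect (A X); first by apply (hm X AX).2.
have [AXZ|nAXZ] := pselect (A (X + Z)); last by rewrite !hA.
by rewrite -((hm _ AXZ).2 (- Z)) ?addrK //; exact/boxN.
Qed.

End LocallyConstant.

Lemma schwartz_slice (R : realType) (L : completeValuedFieldType R) (n : nat)
    (F : 'M[L]_n * 'M[L]_n -> algC) (X : 'M[L]_n) : schwartz F ->
  (forall Y, \forall Y' \near Y, F (X, Y') = F (X, Y)) /\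
  exists2 A : set 'M[L]_n, compact A & forall Y, ~ A Y -> F (X, Y) = 0.
Proof.
move=> [Floc [A cA FA]]; split.
  move=> Y; have [[Q1 Q2] /= [hQ1 hQ2] hQ] := Floc (X, Y).
  apply: filterS hQ2 => Y' hY'; apply: (hQ (X, Y')); split=> //=.
  exact: nbhs_singleton.
exists (snd @` A).
  by apply: continuous_compact cA; apply: continuous_subspaceT => x; exact: cvg_snd.
by move=> Y hY; apply: FA => AXY; apply: hY; exists (X, Y).
Qed.

(** * Unramified local fields *)

Section LocalField.
Variables (R : realType) (p : nat) (p_prime : prime p).
Variables (Qp L : completeValuedFieldType R).
Hypothesis hQp : is_completion (padic_abs R p) (ratr : rat -> Qp).
Variables (M : fieldExtType Qp) (g : {rmorphism L -> M}).
Hypothesis hg : finite_extension g.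
Hypothesis L_val : forall x : L, x != 0 -> exists k : int, vabs x = p%:R ^ k.

Let a0 := @vabs_absolute_value R L.

Lemma vabs_ext_nat (m : nat) : vabs (m%:R : L) = vabs (m%:R : Qp).
Proof. by case: hg => _; apply; rewrite rmorph_nat scaler_nat. Qed.

Lemma ext_ultrametric : ultrametric (@vabs R L).
Proof.
apply: ultrametric_of_nat a0 _ => m; rewrite vabs_ext_nat.
exact: (vabs_padic_nat_le1 p_prime hQp).
Qed.

Lemma ext_orthonormal_basis : exists e : (\dim {:M}).-tuple M, exists N : M -> R,
  [/\ basis_of {:M} e, absolute_value N, ultrametric N,
      forall x, N (g x) = vabs x &
      [/\ forall a : Qp, N a%:A = vabs a,
          forall i : 'I_(\dim {:M}), N e`_i <= 1 &
          forall x i, vabs (coord e i x) <= N x]].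
Proof.
case: hg => -[f gK fK] gv; pose N (x : M) := vabs (f x).
have NE x : N (g x) = vabs x by rewrite /N gK.
have hN : absolute_value N.
  case: a0 => h1 h2 h3 h4; split.
  - by move=> x; exact: h1.
  - move=> x; rewrite -(fK x) NE; split=> [/h2 ->|]; first exact: rmorph0.
    by move=> /eqP; rewrite fmorph_eq0 => /eqP ->; exact/h2.
  - by move=> x y; rewrite -(fK x) -(fK y) -rmorphM !NE.
  - by move=> x y; rewrite -(fK x) -(fK y) -rmorphD !NE.
have uN : ultrametric N.
  move=> x y; rewrite -(fK x) -(fK y) -rmorphD !NE; exact: ext_ultrametric.
have NQ (a : Qp) : N a%:A = vabs a by apply: gv; rewrite fK.
have N_val x : x != 0 -> exists k : int, N x = p%:R ^ k.
  by rewrite -(fK x) fmorph_eq0 NE => /L_val.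
have [e [eb e1 eo]] := orthonormal_basis hN uN NQ (pR_gt1 R p_prime)
  (vabs_padic_p p_prime hQp) N_val.
by exists e, N.
Qed.

Lemma ext_residue_systems : residue_systems L p%:R (p ^ \dim {:M}).
Proof.
have [e [N [eb hN uN NE [NQ e1 eo]]]] := ext_orthonormal_basis.
have [[f gK fK] _] := hg; have fE x : vabs (f x) = N x by rewrite -NE fK.
have fB x y : vabs (x - f y) = N (g x - y) by rewrite -NE rmorphB fK.
move=> j; exists {ffun 'I_(\dim {:M}) -> 'I_(p ^ j)}.
exists (fun c => f (residue e c)); split.
- by rewrite card_ffun !card_ord -!expnM mulnC.
- by move=> c; rewrite fE; apply: (N_residue p_prime hQp hN uN NQ eb e1 eo).
- move=> x x1; have [|c hc] := residue_ex p_prime hQp hN uN NQ eb e1 eo j (x := g x).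
    by rewrite NE.
  by exists c; rewrite fB.
- move=> c c'; rewrite fB fK.
  exact: (residue_inj p_prime hQp eb eo).
Qed.

(** The inverse different of an unramified extension is its ring of integers.
    A non-integral x has absolute value at least p.  Dividing an integer z of
    unit trace by p x therefore gives an integer, whose product with x is z / p,
    and the trace of z / p is not integral. *)
Lemma e_char_unramified : unramified_character (e_char g p : L -> R[i]).
Proof.
have [e [N [eb hN uN NE [NQ e1 eo]]]] := ext_orthonormal_basis.
have e_char1 := e_char_eq1 p_prime hQp g.
split; first exact: (e_charD p_prime hQp).
  move=> x x1; apply/e_char1; apply: le_trans _ x1; rewrite -NE.
  exact: (field_trace_le p_prime hQp hN eb e1 eo).
move=> x x1; have [z z1 trz] := unit_trace p_prime hQp hN uN NQ eb e1 eo.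
have [[f gK fK] _] := hg.
have x0 : x != 0 by rewrite -(abs_gt0 a0) (lt_trans ltr01).
have pR1 := pR_gt1 R p_prime; have pR0 := pR_gt0 R p_prime.
have p0 : p%:R != 0 :> L.
  by rewrite -(abs_gt0 a0) vabs_ext_nat (vabs_padic_p p_prime hQp) invr_gt0.
have [k hk] := L_val x0.
have px : p%:R <= vabs x.
  rewrite hk in x1 *; rewrite -[p%:R]expr1z ler_eXz2l //.
  by move: x1; rewrite -(expr0z p%:R) ltr_eXz2l.
exists (f z / (x * p%:R)).
  rewrite (absM a0) (absV a0) (absM a0) vabs_ext_nat (vabs_padic_p p_prime hQp).
  rewrite invfM invrK -NE fK -[leRHS]mulr1 ler_pM ?(abs_ge0 hN) //.
    by rewrite mulr_ge0 ?invr_ge0 ?(abs_ge0 a0) // ltW.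
  by rewrite mulrC ler_pdivrMr ?mul1r // (lt_le_trans pR0).
have -> : x * (f z / (x * p%:R)) = f z / p%:R by field; rewrite p0 x0.
move=> /e_char1.
have -> : trace_Qp g (f z / p%:R) = (p%:R)^-1 * field_trace z.
  rewrite -(field_traceZ eb) /trace_Qp fmorph_div /= fK rmorph_nat.
  rewrite /field_trace; congr (\tr (passmx.mxof _ _ (amulr _))).
  rewrite mulrC -[in RHS](mul1r z) scalerAl; congr (_ * _).
  by rewrite -in_algE fmorphV rmorph_nat.
rewrite (absM (@vabs_absolute_value R Qp)) trz mulr1.
rewrite (absV (@vabs_absolute_value R Qp)) (vabs_padic_p p_prime hQp) invrK.
by rewrite leNgt pR1.
Qed.

End LocalField.

(** * Local components of the Hecke character *)

Section LocalComponents.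
Variables (R : realType) (K : fieldType) (C : completions R K).
Variables (chi : unitary_hecke C) (v : place R K).
Variables (L : completeValuedFieldType R) (phi : {rmorphism cpl C v -> L}).

Lemma idele_at (y : cpl C v) : y != 0 ->
  exists x : idele C, x v = y /\ forall u, u <> v -> x u = 1.
Proof.
move=> y0.
pose f u : cpl C u := match pselect (v = u) with
  | left e => eq_rect v (fun u => cpl C u) y u e
  | right _ => 1 end.
have fv : f v = y.
  rewrite /f; case: pselect => // e.
  by rewrite (Prop_irrelevance e erefl).
have f1 u : u <> v -> f u = 1.
  by move=> uv; rewrite /f; case: pselect => // e; case: uv.
have f0 u : f u != 0.
  have [->|/f1 ->] := pselect (u = v); first by rewrite fv.
  exact: oner_neq0.
have ffin : finite_set [set u | vabs (f u) != 1].
  apply: (@sub_finite_set _ _ [set v]); last exact: finite_set1.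
  move=> u /=; apply: contraNP => /f1 ->.
  by rewrite (abs1 (@vabs_absolute_value R (cpl C u))).
by exists (Idele f0 ffin).
Qed.

(** The values of a unitary character have absolute value one. *)
Lemma local_component_neq0 psi x : bijective phi ->
  local_component chi phi psi -> x != 0 -> psi x != 0.
Proof.
move=> [f _ fK] hpsi x0.
have [|y [yv y1]] := idele_at (y := f x).
  by apply: contraNneq x0 => fx; rewrite -(fK x) fx rmorph0.
rewrite -(fK x) -yv hpsi //; have := hecke_unitary chi y.
by move=> h; rewrite -normr_eq0 h oner_eq0.
Qed.

Lemma local_component1 psi : local_component chi phi psi -> psi 1 = 1.
Proof.
move=> hpsi; have [y [yv y1]] := idele_at (oner_neq0 (cpl C v)).
rewrite -(rmorph1 phi) -yv hpsi //; apply: (@hecke_principal _ _ _ chi 1) => u.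
rewrite rmorph1; have [->//|] := pselect (u = v); exact: y1.
Qed.

End LocalComponents.

(** * The Siegel section on the big cell *)

Lemma cexp0 (R : realType) : cexp (0 : R[i]) = 1.
Proof. by rewrite /cexp /= expR0 cos0 sin0 mul1r. Qed.

Lemma cpow1 (R : realType) (z : R[i]) : cpow 1 z = 1.
Proof. by rewrite /cpow ln1 mulr0 cexp0. Qed.

Section BigCell.
Variables (L : fieldType) (n : nat).
Implicit Types N X : 'M[L]_n.

Definition big_cell N : 'M[L]_(n + n) :=
  block_mx 0 1%:M (- 1%:M) 0 *m block_mx 1%:M N 0 1%:M.

Lemma row_mx_big_cell N X : row_mx 0 X *m big_cell N = row_mx (- X) (- (X *m N)).
Proof.
rewrite /big_cell mulmx_block !mul0mx !mulmx0 !mul1mx !mulmx1 !add0r !addr0.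
by rewrite mul_row_block !mul0mx !add0r mulmxN mulmx1 mulNmx mul1mx mulmxN.
Qed.

Lemma det_big_cell N : \det (big_cell N) = 1.
Proof.
rewrite /big_cell det_mulmx det_ublock !det1 !mulr1.
(* the Weyl element as a product of unipotent matrices *)
have -> : block_mx 0 1%:M (- 1%:M) 0 = block_mx 1%:M 1%:M 0 1%:M *m
    (block_mx 1%:M 0 (- 1%:M) 1%:M *m block_mx 1%:M 1%:M 0 1%:M) :> 'M[L]_(n + n).
  rewrite !mulmx_block !mul0mx !mulmx0 !mul1mx !mulmx1 ?mulmxN ?mulNmx ?mul1mx.
  by rewrite ?addr0 ?add0r ?mulmx1 ?addNr ?subrr ?addr0 ?add0r.
by rewrite !det_mulmx !det_ublock det_lblock !det1 !mulr1.
Qed.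

End BigCell.

Section IntegralMatrices.
Variables (R : realType) (L : completeValuedFieldType R).
Hypothesis uL : ultrametric (@vabs R L).
Let a0 := @vabs_absolute_value R L.

Lemma det_integral n (A : 'M[L]_n) : box 1 A -> vabs (\det A) <= 1.
Proof.
move=> hA; apply: (abs_le_sum a0 uL) => // s _.
have prod_le1 (I : finType) (f : I -> L) :
    (forall i, vabs (f i) <= 1) -> vabs (\prod_i f i) <= 1.
  move=> hf; apply: (big_ind (fun x => vabs x <= 1)) => [||//].
    by rewrite (abs1 a0).
  by move=> x y hx hy; rewrite (absM a0) -[leRHS]mul1r ler_pM ?(abs_ge0 a0).
rewrite (absM a0) (absX a0) (absN a0) (abs1 a0) expr1n mul1r.
by apply: prod_le1 => i; exact: hA.
Qed.

Lemma box_invmx n (A : 'M[L]_n) : GL_int A -> A \in unitmx /\ box 1 (invmx A).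
Proof.
move=> [hA dA].
have d0 : \det A != 0 by rewrite -(abs_gt0 a0) dA.
have uA : A \in unitmx by rewrite unitmxE unitfE.
split=> // i j; rewrite /invmx uA !mxE (absM a0) (absV a0) dA invr1 mul1r.
rewrite /cofactor (absM a0) (absX a0) (absN a0) (abs1 a0) expr1n mul1r.
by apply: det_integral => k l; rewrite !mxE.
Qed.

End IntegralMatrices.

Section SiegelSection.
Variables (R : realType) (p : nat) (Qp L : completeValuedFieldType R).
Variables (M : fieldExtType Qp) (g : {rmorphism L -> M}).
Variables (t : R) (w : L) (q n : nat).
Hypotheses (uL : ultrametric (@vabs R L)) (t1 : 1 < t) (wt : vabs w = t^-1).
Hypothesis res : residue_systems L t q.
Hypothesis hpsi : unramified_character (e_char g p : L -> R[i]).
Variables (chi1 chi2 : L -> R[i]) (s : R[i]).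
Hypotheses (chi1_neq0 : forall x, x != 0 -> chi1 x != 0)
  (chi2_neq0 : forall x, x != 0 -> chi2 x != 0) (chi2_1 : chi2 1 = 1).
Variables (mu nu : {measure set (borelM L n) -> \bar R}).
Hypotheses (hmu : additive_haar mu) (hnu : GL_haar nu).
Variable Gamma : set 'M[L]_n.
Hypotheses (GammaG : Gamma `<=` @GL_int R L n).
Hypotheses (cGamma : compact Gamma) (oGamma : open Gamma).
Variable f : 'M[L]_n * 'M[L]_n -> R[i].
Hypothesis f_supp : forall X Y, ~ Gamma X -> f (X, Y) = 0.
Hypothesis f_equiv : forall X Y, Gamma X ->
  f (X, (invmx X)^T *m Y) = chi1 (\det X) * (chi2 (\det X))^-1 * f (1%:M, Y).
Variable m : nat.
Hypothesis f_step : step t m (fun Y => f (1%:M, Y)).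

Let h Y := f (1%:M, Y).
Let a0 := @vabs_absolute_value R L.

(** With h Y = f (1, Y), equivariance reads f (X, Y) = c h (X^T Y), and the trace
    in the character is that of (X^T Y) N^T, so that the integrand is a function
    of X^T Y.  The substitution by X^T preserves the integral. *)
Lemma partial_fourier_Gamma X N : Gamma X ->
  partial_fourier g p mu f (X, - (X *m N)) =
  chi1 (\det X) * (chi2 (\det X))^-1 * fourier mu (e_char g p) h N.
Proof.
move=> GX; have [uX X1] := box_invmx uL (GammaG GX).
have [k' hk'] := box_exists t1 N; pose k := maxn m k'.
have hk : box (t ^+ k) N by apply: box_le hk'; rewrite tX_le // leq_maxr.
have hh : step t k h by apply: step_le f_step; rewrite // leq_maxl.
have hs := step_pairing uL t1 hpsi hh hk.
set c := _ / _; rewrite -(cintegral_stepZ uL t1 wt res hmu _ hs).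
have XT1 : box 1 X^T by apply: box_tr; case: (GammaG GX).
have XTV1 : box 1 (invmx X^T) by rewrite -trmx_inv; exact: box_tr.
have hcs : step t k (fun Y => c * (h Y * pairing (e_char g p) Y N)).
  by case: hs => h1 h2; split=> [Y /h1 ->|Y Z /h2 ->] //; rewrite mulr0.
rewrite -(cintegral_step_mulmx uL t1 wt res hmu hcs XT1 XTV1) ?unitmx_tr //.
rewrite /partial_fourier /=; congr (cintegral mu _ _); apply/funext => Y.
rewrite /= [RHS]mulrA /h /c -f_equiv // mulmxA -trmx_mul mulmxV // trmx1 mul1mx.
congr (_ * e_char g p _); rewrite linearN /= mulmxN linearN /= opprK trmx_mul mulmxA.
by rewrite mxtrace_mulC mulmxA.
Qed.

Lemma partial_fourier_notin X Y : ~ Gamma X -> partial_fourier g p mu f (X, Y) = 0.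
Proof.
move=> GX; rewrite /partial_fourier /=.
rewrite (@cintegral_simple _ _ _ mu setT 'I_0 (fun=> set0) (fun=> 0)) //.
- by rewrite big_ord0.
- by move=> _; rewrite measure0.
- by move=> Z _; rewrite big_ord0 f_supp // mul0r.
- by move=> Z; case.
Qed.

(** The factor in partial_fourier_Gamma cancels the characters in the section,
    and det X has absolute value one on Gamma: the integrand is constant on Gamma
    and zero elsewhere. *)
Lemma siegel_section_big_cell N :
  siegel_section M chi1 chi2 s nu
    (fun XY => partial_fourier g p mu f (- XY.1, XY.2)) (big_cell N) =
  (fine (nu Gamma))%:C * fourier mu (e_char g p) h N.
Proof.
have norm1 (x : L) : vabs x = 1 -> norm_abs M x = 1.
  by move=> x1; rewrite /norm_abs x1 expr1n.
rewrite /siegel_section det_big_cell chi2_1 norm1 ?(abs1 a0) // cpow1 !mul1r.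
have mG : measurable (Gamma : set (borelM L n)) by exact: sub_sigma_algebra.
have GGL : Gamma `<=` @GL R L n by move=> X /GammaG/(box_invmx uL)[].
rewrite (@cintegral_simple _ _ _ nu (@GL R L n) unit
  (fun=> Gamma) (fun=> fourier mu (e_char g p) h N)) //.
- by rewrite big_const card_unit /= addr0 mulrC.
- by move=> _; case: hnu => _ hfin _; apply: hfin.
- move=> X _; rewrite big_const card_unit /= addr0.
  rewrite row_mx_big_cell row_mxKl row_mxKr opprK.
  have [GX|GX] := pselect (Gamma X).
    have dX : vabs (\det X) = 1 by case: (GammaG GX).
    have d0 : \det X != 0 by rewrite -(abs_gt0 a0) dX.
    rewrite indicE (mem_set GX) [RHS]mulr1.
    rewrite (partial_fourier_Gamma N GX).
    rewrite (norm1 _ dX).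
    rewrite cpow1 mulr1.
    by field; rewrite chi1_neq0 // chi2_neq0.
  by rewrite indicE (memNset GX) [RHS]mulr0 partial_fourier_notin // !mul0r.
- by move=> X XGL _ /GGL.
Qed.

Lemma fourier_coeff_siegel_section beta :
  fourier_coeff g p mu beta (siegel_section M chi1 chi2 s nu
    (fun XY => partial_fourier g p mu f (- XY.1, XY.2))) =
  (fine (nu Gamma))%:C * f (1%:M, beta^T).
Proof.
rewrite -(fourier_inversion uL t1 wt res hmu hpsi beta^T f_step) -/h.
have [k' hk'] := box_exists t1 beta^T; pose k := maxn m k'.
have hk : box (t ^+ k) (- beta^T).
  by apply/boxN; apply: box_le hk'; rewrite tX_le // leq_maxr.
have hh : step t k (fourier mu (e_char g p) h).
  by apply: (step_fourier uL t1 wt res hmu hpsi); apply: step_le f_step; rewrite // leq_maxl.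
have hs := step_pairing uL t1 hpsi hh hk.
under [in RHS]eq_fun do rewrite pairingC.
rewrite -(cintegral_stepZ uL t1 wt res hmu _ hs) /fourier_coeff.
congr (cintegral mu _ _); apply/funext => N.
rewrite -/(big_cell N) siegel_section_big_cell -mulrA; congr (_ * (_ * e_char g p _)).
by rewrite [(- beta^T)^T]linearN /= trmxK mulmxN raddfN /= mxtrace_mulC.
Qed.

End SiegelSection.

(** * The Fourier coefficient *)

Theorem lemma10
  (R : realType)
  (* the CM field K, its maximal totally real subfield E, the prime p *)
  (K : fieldExtType rat) (E : {subfield K}) (hCM : is_CM E)
  (c : {rmorphism K -> K}) (hc : complex_conjugation E c)
  (p : nat) (hp : prime p)
  (hunram : unramified_in R K p) (hsplit : splits_in R E p)
  (* the chosen primes above p, one of them v, and its conjugate vbar *)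
  (S : set (place R K)) (hS : one_over_each E p S)
  (v vbar : place R K) (hv : S v) (hvbar : forall x, vbar x = v (c x))
  (* the local field E_v = K_v over Qp *)
  (Qp : completeValuedFieldType R)
  (hQp : is_completion (padic_abs R p) (ratr : rat -> Qp))
  (Ev : completeValuedFieldType R)
  (M : fieldExtType Qp) (g : {rmorphism Ev -> M}) (hg : finite_extension g)
  (iota : {rmorphism K -> Ev})
  (hKv : is_completion v iota)
  (hEv : is_completion (fun x : subvs_of E => v (vsval x))
                       (fun x : subvs_of E => iota (vsval x)))
  (* the unitary Hecke character chi of K and chi1, chi2 *)
  (C : completions R K) (chi : unitary_hecke C)
  (phi : {rmorphism cpl C v -> Ev}) (hphi : identification iota phi)
  (phibar : {rmorphism cpl C vbar -> Ev})
  (hphibar : identification (fun x => iota (c x)) phibar)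
  (chi1 chi2 : Ev -> R[i])
  (hchi1 : local_component chi phi chi1)
  (hchi2 : local_component chi phibar (fun x => (chi2 x)^-1))
  (* the parameters n, s, the Haar measures, the embedding of Qbar *)
  (n : nat) (s : R[i])
  (mu : {measure set (borelM Ev n) -> \bar R}) (hmu : additive_haar mu)
  (nu : {measure set (borelM Ev n) -> \bar R}) (hnu : GL_haar nu)
  (incl : {rmorphism algC -> R[i]})
  (* Gamma and F *)
  (Gamma : set 'M[Ev]_n)
  (hGamma : Gamma `<=` @GL_int R Ev n)
  (hGamma_compact : compact Gamma) (hGamma_open : open Gamma)
  (F : 'M[Ev]_n * 'M[Ev]_n -> algC) (hF : schwartz F)
  (hF_supp : [set X | exists Y, F (X, Y) != 0] = Gamma)
  (hF_equiv : forall X Y : 'M[Ev]_n, Gamma X ->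
     incl (F (X, (invmx X)^T *m Y)) =
     chi1 (\det X) * (chi2 (\det X))^-1 * incl (F (1%:M, Y)))
  (beta : 'M[Ev]_n) :
  fourier_coeff g p mu beta
    (siegel_section M chi1 chi2 s nu
       (fun XY => partial_fourier g p mu (fun Z => incl (F Z)) (- XY.1, XY.2))) =
  (fine (nu Gamma))%:C * incl (F (1%:M, beta^T)).
Proof.
have pv : above p v by case: hS => h _; exact: h.
have a0 := @vabs_absolute_value R Ev.
have uN : ultrametric (@vabs R Ev) := ext_ultrametric hp hQp hg.
have Ev_val (x : Ev) : x != 0 -> exists k : int, vabs x = p%:R ^ k.
  (* the values of K are powers of p, and K is dense in Ev *)
  move=> x0; have vx0 : 0 < vabs x by rewrite (abs_gt0 a0).
  case: hKv => hv' dv; have [_ [y _ <-] xy] := dense_approx x dv vx0.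
  have vy : vabs x = vabs (iota y).
    by rewrite (abs_eq_of_close a0 uN (x := iota y) (y := x)) // (absB a0).
  rewrite vy hv'; apply: hunram => //; apply: contraTneq vx0 => y0.
  by rewrite vy y0 rmorph0 (abs0 a0) ltxx.
have vabs_p : vabs (p%:R : Ev) = p%:R^-1.
  by rewrite (vabs_ext_nat hg) (vabs_padic_p hp hQp).
have res := ext_residue_systems hp hQp hg Ev_val.
have psi_unr := e_char_unramified hp hQp hg Ev_val.
have chi1_neq0 x : x != 0 -> chi1 x != 0.
  by case: hphi => bij _ _; exact: (local_component_neq0 bij hchi1).
have chi2_neq0 x : x != 0 -> chi2 x != 0.
  case: hphibar => bij _ _ /(local_component_neq0 bij hchi2).
  by rewrite invr_eq0.
have chi2_1 : chi2 1 = 1 by rewrite -[LHS]invrK (local_component1 hchi2) invr1.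
have [Floc [A cA FA]] := schwartz_slice (1%:M : 'M[Ev]_n) hF.
have [m hm] : exists m, step p%:R m (fun Y => incl (F (1%:M, Y))).
  apply: (step_of_locally_constant uN (pR_gt1 R hp) _ cA) => [X|X /FA ->].
    by apply: filterS (Floc X) => Y ->.
  exact: rmorph0.
have f_supp X Y : ~ Gamma X -> incl (F (X, Y)) = 0.
  move=> GX; have [->|F0] := eqVneq (F (X, Y)) 0; first exact: rmorph0.
  by case: GX; rewrite -hF_supp; exists Y.
exact: (fourier_coeff_siegel_section uN (pR_gt1 R hp) vabs_p res psi_unr s
  chi1_neq0 chi2_neq0 chi2_1 hmu hnu hGamma hGamma_compact hGamma_open
  f_supp hF_equiv hm).
Qed.
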